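(* Let $n \ge 5$ and let $s \in \{N,U\}^n$ be a cyclic sequence. Then the following are equivalent. (i) There is some convex $n$-gon $C$ with a unique minimum area convex polygon $Q$ inscribed in $C$ such that $s^C(Q)=s$. (ii) The cyclic sequence $s$ contains no two consecutive $N$s and no three consecutive $U$s.
   Context: A convex polygon $Q$ is inscribed in a convex polygon $C$ if every side of $C$ contains at least one vertex of $Q$. A minimum area convex polygon inscribed in $C$ is a convex polygon $Q$ inscribed in $C$ with $\operatorname{area}(Q)=\inf\{\operatorname{area}(Q') : Q' \text{ is inscribed in } C\}$. A cyclic sequence is a sequence $s=(s_1,\dots,s_n)$ whose indices are understood modulo $n$; consecutiveness of elements is understood cyclically. If $C$ is a convex $n$-gon with vertices $p_1,\dots,p_n$ in counterclockwise order and $Q$ is inscribed in $C$, the cyclic sequence $s^C(Q)\in\{U,N\}^n$ associated to $Q$ is defined by: its $k$th element is $U$ (''used'') if $p_k$ is a vertex of $Q$, and $N$ otherwise. *)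

(* Defs.v *)
From HB Require Import structures.
From mathcomp Require Import all_boot all_order all_algebra.
From mathcomp Require Import all_classical all_reals all_analysis.

Set Implicit Arguments.
Unset Strict Implicit.
Unset Printing Implicit Defensive.

Import Order.TTheory GRing.Theory Num.Theory.

Local Open Scope classical_set_scope.
Local Open Scope ring_scope.

(* [R^o] rather than [R]: the plane must be an [lmodType R]. *)
Definition plane (R : realType) : lmodType R := (R^o * R^o)%type.

(* Twice the signed area of the triangle [abc]: positive iff [c] is strictly
   to the left of the line directed from [a] to [b]. *)
Definition orient (R : realType) (a b c : plane R) : R :=
  (b.1 - a.1) * (c.2 - a.2) - (b.2 - a.2) * (c.1 - a.1).

(* [v] lists the vertices of a nondegenerate convex polygon counterclockwise:
   every vertex off the edge from [v i] to its cyclic successor lies strictly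
   to the left of that edge. In particular the [v i] are pairwise distinct and
   are exactly the extreme points of their convex hull. *)
Definition convex_ngon (R : realType) (n : nat) (v : 'I_n -> plane R) : Prop :=
  (3 <= n)%N /\
  forall i k : 'I_n, k != i -> k != ordS i ->
    0 < orient (v i) (v (ordS i)) (v k).

Definition region (R : realType) (n : nat) (v : 'I_n -> plane R) :
    set (plane R) :=
  smallest (@convex_set R (plane R)) (range v).

Definition area (R : realType) (A : set (plane R)) : \bar R :=
  (@lebesgue_measure R \x @lebesgue_measure R)%E (A : set (R * R)).

Definition segment (R : realType) (a b : plane R) : set (plane R) :=
  [set (1 - t) *: a + t *: b | t in `[0, 1]%classic].

Definition side (R : realType) (n : nat) (p : 'I_n -> plane R) (i : 'I_n) :
    set (plane R) :=
  segment (p i) (p (ordS i)).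

Definition inscribed (R : realType) (n m : nat)
    (p : 'I_n -> plane R) (q : 'I_m -> plane R) : Prop :=
  convex_ngon q /\ forall i : 'I_n, exists j : 'I_m, side p i (q j).

(* The number of vertices of the inscribed polygon is arbitrary. *)
Definition inscribed_areas (R : realType) (n : nat) (p : 'I_n -> plane R) :
    set (\bar R) :=
  [set a | exists m (q : 'I_m -> plane R),
     inscribed p q /\ a = area (region q)].

Definition min_area_inscribed (R : realType) (n m : nat)
    (p : 'I_n -> plane R) (q : 'I_m -> plane R) : Prop :=
  inscribed p q /\ area (region q) = ereal_inf (inscribed_areas p).

(* A polygon is a region of the plane: uniqueness disregards the choice of the
   first vertex in the enumeration [q]. *)
Definition unique_min_area_inscribed (R : realType) (n m : nat)
    (p : 'I_n -> plane R) (q : 'I_m -> plane R) : Prop :=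
  min_area_inscribed p q /\
  forall m' (q' : 'I_m' -> plane R),
    min_area_inscribed p q' -> region q' = region q.

Inductive mark : Type := Used | Unused.

(* Cyclic sequences are indexed by ['I_n] with cyclic successor [ordS]. *)
Definition used_seq (R : realType) (n m : nat)
    (p : 'I_n -> plane R) (q : 'I_m -> plane R) : {ffun 'I_n -> mark} :=
  [ffun k => if p k \in range q then Used else Unused].

Definition no_two_consecutive_unused (n : nat) (s : {ffun 'I_n -> mark}) :
    Prop :=
  ~ exists i : 'I_n, s i = Unused /\ s (ordS i) = Unused.

Definition no_three_consecutive_used (n : nat) (s : {ffun 'I_n -> mark}) :
    Prop :=
  ~ exists i : 'I_n,
      [/\ s i = Used, s (ordS i) = Used & s (ordS (ordS i)) = Used].

(* Main.v *)
(* If both endpoints of a side are unused, the vertex of the polygon inside that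
   side can be moved slightly in both directions, and the area depends affinely
   on the displacement: one of the directions does not increase the area, against
   unique minimality. If three consecutive vertices are used, the middle one can
   be dropped.

   Conversely, let [w k] be the double area of the ear of [p] at its vertex [k]. A
   polygon with a vertex at parameter [t i] on each side [i] misses at most the
   corners of [p], of double area [y k * w k] with
   [y k = (1 - t (k - 1)) * t k], and [y k + y (k + 1) <= 1]. So if each unused
   vertex has a larger ear than its two neighbors together, the sum is maximal,
   and only so, when [y k = 1] at the unused vertices, which characterizes the
   polygon of the used vertices. Such a [p] is obtained by perturbing points of a
   parabola: isolated used vertices go near the midpoint of their neighbors and
   pairs of used vertices are nearly merged, which makes their ears small. *)
Require Import Defs.
From HB Require Import structures.
From mathcomp Require Import all_boot all_order all_algebra.
From mathcomp Require Import all_classical all_reals all_analysis.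
From mathcomp Require Import measurable_realfun.
From mathcomp Require Import zify ring lra.

Set Implicit Arguments.
Unset Strict Implicit.
Unset Printing Implicit Defensive.

Import Order.TTheory GRing.Theory Num.Theory.
Import numFieldNormedType.Exports.

Local Open Scope classical_set_scope.
Local Open Scope ring_scope.

(** * Measurability and strips *)

Section Area.
Variable R : realType.

Definition area_measure : {measure set (measurableTypeR R * measurableTypeR R) -> \bar R} :=
  (@lebesgue_measure R \x @lebesgue_measure R)%E.

Lemma xsectionP (A : set (R * R)) x y : xsection A x y <-> A (x, y).
Proof. by rewrite /xsection /= inE. Qed.

Lemma integral_affine (u v x0 x1 : R) : x0 < x1 ->
  (\int[@lebesgue_measure R]_(x in `]x0, x1[) (u * x + v)%:E =
   ((x1 - x0) * ((u * x0 + v) + (u * x1 + v)) / 2)%:E)%E.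
Proof.
move=> x01.
have dF (x : R) : is_derive x 1 (fun x : R => u / 2 * x ^+ 2 + v * x) (u * x + v).
  by apply: is_derive_eq; rewrite /GRing.scale /=; field.
rewrite -(@integral_itv_bndoo _ _ _ _ true false); last first.
  by apply/measurable_EFinP; apply: measurable_funD => //; exact: measurable_funM.
rewrite (@continuous_FTC2 _ _ (fun x => u / 2 * x ^+ 2 + v * x))//.
- by rewrite -EFinB; congr EFin; field.
- apply: continuous_subspaceT => x.
  by apply: cvgD; [apply: cvgM => //; exact: cvg_cst|exact: cvg_cst].
- have cF (x : R) : {for x, continuous (fun x : R => u / 2 * x ^+ 2 + v * x)}.
    by apply: differentiable_continuous; apply/derivable1_diffP.
  split.
  + by move=> x _; exact: ex_derive.
  + by apply: cvg_at_right_filter; exact: cF.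
  + by apply: cvg_at_left_filter; exact: cF.
- by move=> x _; rewrite derive1E; exact: derive_val.
Qed.

(** The vertical sections are open intervals of affine length. The case [x0 = x1] is kept so that a
    triangle with a vertical side needs no treatment of its own. *)
Lemma area_strip (l1 l0 u1 u0 x0 x1 : R) : x0 <= x1 ->
  (forall x, x0 < x < x1 -> l1 * x + l0 <= u1 * x + u0) ->
  area_measure [set z | x0 < z.1 < x1 /\ l1 * z.1 + l0 < z.2 < u1 * z.1 + u0] =
  ((x1 - x0) * (((u1 - l1) * x0 + (u0 - l0)) + ((u1 - l1) * x1 + (u0 - l0)))
    / 2)%:E.
Proof.
rewrite le_eqVlt => /predU1P[->|x01] lu.
  rewrite subrr !mul0r (_ : [set _ | _] = set0) ?measure0//.
  by rewrite -subset0 => z [/andP[/lt_trans /[apply]]]; rewrite ltxx.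
rewrite -integral_affine// integral_mkcond.
apply: eq_integral => x _ /=.
rewrite patchE; case: ifPn => [|xn].
  rewrite inE /= in_itv /= => xx.
  rewrite (_ : xsection _ _ = `]l1 * x + l0, u1 * x + u0[%classic); last first.
    by apply/seteqP; split => y; rewrite xsectionP /= in_itv /=; [case|split].
  rewrite lebesgue_measure_itv /= lte_fin; case: ifPn => [_|].
    by rewrite -EFinB; congr EFin; ring.
  by rewrite -leNgt => ul; congr EFin; have := lu _ xx; lra.
rewrite (_ : xsection _ _ = set0) ?measure0// -subset0 => y; rewrite xsectionP /= => -[xx _].
by move: xn; rewrite notin_setE /= in_itv /=.
Qed.

Lemma area_line (a b c : R) : (a != 0) || (b != 0) ->
  area_measure [set z | a * z.1 + b * z.2 = c] = 0%E.
Proof.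
have [->|b0 _] := eqVneq b 0.
  rewrite orbF => a0.
  rewrite (_ : [set _ | _] = [set c / a] `*` setT); last first.
    apply/seteqP; split => -[x y] /=; rewrite mul0r addr0.
      by move=> <-; split => //; field.
    by move=> [-> _]; field.
  rewrite [LHS]product_measure1E//.
  by rewrite [X in (X * _)%E](_ : _ = 0%E) ?mul0e//; exact: lebesgue_measure_set1.
rewrite [LHS]integral0_eq// => x _ /=.
rewrite (_ : xsection _ _ = [set (c - a * x) / b]) ?lebesgue_measure_set1//.
apply/seteqP; split => y; rewrite xsectionP /=.
  by move=> <-; field.
by move=> ->; field.
Qed.


Lemma measurable_orient (a b : plane R) :
  measurable_fun setT (fun z : measurableTypeR R * measurableTypeR R => orient a b z).
Proof.
rewrite /orient; apply: measurable_funB; apply: measurable_funM => //;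
  apply: measurable_funB => //; exact: measurable_snd || exact: measurable_fst.
Qed.

Definition halfplane (a b : plane R) : set (measurableTypeR R * measurableTypeR R) :=
  [set z | 0 <= orient a b z].

Definition open_halfplane (a b : plane R) : set (measurableTypeR R * measurableTypeR R) :=
  [set z | 0 < orient a b z].

Lemma measurable_halfplane (a b : plane R) : measurable (halfplane a b).
Proof.
have := measurable_orient a b => /(_ measurableT `[0, +oo[%classic (measurable_itv _)).
by rewrite setTI; congr measurable; apply/seteqP; split => z /=; rewrite in_itv /= andbT.
Qed.

Lemma measurable_open_halfplane (a b : plane R) : measurable (open_halfplane a b).
Proof.
have := measurable_orient a b => /(_ measurableT `]0, +oo[%classic (measurable_itv _)).
by rewrite setTI; congr measurable; apply/seteqP; split => z /=; rewrite in_itv /= andbT.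
Qed.

Definition open_triangle (a b c : plane R) :=
  open_halfplane a b `&` (open_halfplane b c `&` open_halfplane c a).

Lemma measurable_open_triangle a b c : measurable (open_triangle a b c).
Proof. by apply: measurableI; [|apply: measurableI]; exact: measurable_open_halfplane. Qed.

End Area.

(** * The area of a triangle *)

Section Triangle.
Variable R : realType.
Local Notation mu := (area_measure R).
Local Notation P2 := (measurableTypeR R * measurableTypeR R)%type.

(** The vertical line at [x1] is null, so the points of [A] on it do not matter. *)
Lemma area_two_strips (l1 l0 u1 u0 k1 k0 v1 v0 x0 x1 x2 : R) (A : set P2) :
  measurable A -> x0 <= x1 -> x1 <= x2 ->
  (forall x, x0 < x < x1 -> l1 * x + l0 <= u1 * x + u0) ->
  (forall x, x1 < x < x2 -> k1 * x + k0 <= v1 * x + v0) ->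
  (forall z, A z -> x0 < z.1 < x2) ->
  (forall z, x0 < z.1 < x1 -> A z <-> l1 * z.1 + l0 < z.2 < u1 * z.1 + u0) ->
  (forall z, x1 < z.1 < x2 -> A z <-> k1 * z.1 + k0 < z.2 < v1 * z.1 + v0) ->
  mu A =
  ((x1 - x0) * (((u1 - l1) * x0 + (u0 - l0)) + ((u1 - l1) * x1 + (u0 - l0))) / 2
  + (x2 - x1) * (((v1 - k1) * x1 + (v0 - k0)) + ((v1 - k1) * x2 + (v0 - k0))) / 2)%:E.
Proof.
move=> mA x01 x12 lu kv Ax A1 A2.
rewrite EFinD -(area_strip x01 lu) -(area_strip x12 kv).
set S1 := [set z | _]; set S2 := [set z | x1 < _ < _ /\ _].
have mS1 : measurable (S1 : set P2).
  rewrite (_ : S1 = A `&` (`]x0, x1[ `*` setT)).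
    by apply: measurableI => //; exact: measurableX.
  apply/seteqP; split => z /=; rewrite in_itv /=.
    by move=> [zx zz]; split => //; apply/A1.
  by move=> [Az [zx _]]; split => //; apply/A1.
have mS2 : measurable (S2 : set P2).
  rewrite (_ : S2 = A `&` (`]x1, x2[ `*` setT)).
    by apply: measurableI => //; exact: measurableX.
  apply/seteqP; split => z /=; rewrite in_itv /=.
    by move=> [zx zz]; split => //; apply/A2.
  by move=> [Az [zx _]]; split => //; apply/A2.
have L0 : mu [set z | 1 * z.1 + 0 * z.2 = x1] = 0%E by apply: area_line; rewrite oner_eq0.
have mL : measurable ([set z | 1 * z.1 + 0 * z.2 = x1] : set P2).
  have mf : measurable_fun setT (fun z : P2 => 1 * z.1 + 0 * z.2 : R).
    by apply: measurable_funD; apply: measurable_funM.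
  by have := mf measurableT [set x1] (measurable_set1 _); rewrite setTI.
have dS : S1 `&` S2 = set0.
  rewrite -subset0 => z [[/andP[_ z1] _] [/andP[z2 _] _]].
  by have := lt_trans z1 z2; rewrite ltxx.
rewrite -measureU//; apply/eqP; rewrite eq_le; apply/andP; split.
  apply: (@le_trans _ _ (mu ((S1 `|` S2) `|` [set z | 1 * z.1 + 0 * z.2 = x1]))).
    apply: le_measure; rewrite ?inE//; first by do 2 apply: measurableU => //.
    move=> z Az; have /andP[z0 z2] := Ax z Az.
    case: (ltgtP z.1 x1) => zx.
    - by left; left; split; rewrite ?z0//; apply/A1 => //; rewrite z0.
    - by left; right; split; rewrite ?zx//; apply/A2 => //; rewrite zx.
    - by right => /=; rewrite zx; ring.
  apply: le_trans (measureU2 _ _ _) _ => //; first exact: measurableU.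
  by rewrite [X in (_ + X)%E]L0 adde0.
apply: le_measure; rewrite ?inE//; first exact: measurableU.
by move=> z [[zx zz]|[zx zz]]; [apply/A1|apply/A2].
Qed.

Lemma orientE (x y x' y' u v : R) :
  orient ((x, y) : plane R) (x', y') (u, v) = (x' - x) * (v - y) - (y' - y) * (u - x).
Proof. by []. Qed.

Lemma orient_sum (a b c z : plane R) :
  orient a b z + orient b c z + orient c a z = orient a b c.
Proof. by rewrite /orient; ring. Qed.

Lemma orient_rot (a b c : plane R) : orient b c a = orient a b c.
Proof. by rewrite /orient; ring. Qed.

Lemma orient_swap (a b c : plane R) : orient b a c = - orient a b c.
Proof. by rewrite /orient; ring. Qed.

(** The vertical line through the middle vertex cuts the triangle into two strips. The two claims
    correspond to a middle vertex below and above the line through [a] and [c]. *)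
Lemma area_open_triangle_sorted (a1 a2 b1 b2 c1 c2 : R)
    (a := (a1, a2) : plane R) (b := (b1, b2) : plane R) (c := (c1, c2) : plane R) :
  a1 <= b1 -> b1 <= c1 ->
  (0 < orient a b c -> mu (open_triangle a b c) = (orient a b c / 2)%:E) /\
  (0 < orient a c b -> mu (open_triangle a c b) = (orient a c b / 2)%:E).
Proof.
rewrite {}/a {}/b {}/c => ab bc.
(* The slope of a side. For a vertical side it takes the default value 0, which is harmless because
   the strip then has width 0. *)
pose s (x y x' y' : R) := (y' - y) / (x' - x).
have oE (x y x' y' : R) z : x < x' ->
    orient (x, y) (x', y') z = (x' - x) * (z.2 - (s x y x' y' * z.1 + (y - s x y x' y' * x))).
  by move=> xx; rewrite /s; case: z => z1 z2; rewrite orientE /=; field; rewrite subr_eq0 gt_eqF.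
have oE0 (x y x' y' : R) z : x < x' ->
    (0 < orient (x, y) (x', y') z) = (s x y x' y' * z.1 + (y - s x y x' y' * x) < z.2).
  by move=> xx; rewrite oE// pmulr_rgt0 ?subr_gt0//.
have oE1 (x y x' y' : R) z : x < x' ->
    (0 < orient (x', y') (x, y) z) = (z.2 < s x y x' y' * z.1 + (y - s x y x' y' * x)).
  by move=> xx; rewrite orient_swap oE// -mulrN pmulr_rgt0 ?subr_gt0// opprB subr_gt0.
split => D0.
- have ac : a1 < c1.
    rewrite lt_neqAle (le_trans ab bc) andbT; apply/eqP => E; move: D0.
    have b1E : b1 = a1 by lra.
    by rewrite orientE b1E -E !subrr mul0r mulr0 subrr ltxx.
  (* Barycentric identities for the first coordinate, with the origin at each vertex in turn. They
     place [z] between the extreme abscissas and, within either strip, yield the third side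
     inequality from the other two. *)
  have bary z : (z.1 - b1) * orient (a1, a2) (b1, b2) (c1, c2) =
     (a1 - b1) * orient (b1, b2) (c1, c2) z + (c1 - b1) * orient (a1, a2) (b1, b2) z.
    by rewrite /orient /=; ring.
  have bary' z : (z.1 - a1) * orient (a1, a2) (b1, b2) (c1, c2) =
     (b1 - a1) * orient (c1, c2) (a1, a2) z + (c1 - a1) * orient (a1, a2) (b1, b2) z.
    by rewrite /orient /=; ring.
  have bary'' z : (c1 - z.1) * orient (a1, a2) (b1, b2) (c1, c2) =
     (c1 - a1) * orient (b1, b2) (c1, c2) z + (c1 - b1) * orient (c1, c2) (a1, a2) z.
    by rewrite /orient /=; ring.
  rewrite (@area_two_strips (s a1 a2 b1 b2) (a2 - s a1 a2 b1 b2 * a1)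
     (s a1 a2 c1 c2) (a2 - s a1 a2 c1 c2 * a1)
     (s b1 b2 c1 c2) (b2 - s b1 b2 c1 c2 * b1)
     (s a1 a2 c1 c2) (a2 - s a1 a2 c1 c2 * a1) a1 b1 c1)//.
  + have ac0 : c1 - a1 != 0 by rewrite subr_eq0 gt_eqF.
    congr EFin; move: D0; rewrite !orientE /s.
    have [<-|nab] := eqVneq a1 b1.
      by move=> _; rewrite !subrr invr0 mulr0; field.
    have [->|nbc] := eqVneq b1 c1.
      by move=> _; rewrite !subrr invr0 mulr0; field.
    by move=> _; field; rewrite ac0 !subr_eq0 (eq_sym b1) nab (eq_sym c1) nbc.
  + exact: measurable_open_triangle.
  + move=> x /andP[ax xb]; have ab' : a1 < b1 by lra.
    have := bary' (x, s a1 a2 c1 c2 * x + (a2 - s a1 a2 c1 c2 * a1)).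
    rewrite (orient_swap (a1, a2)) (oE a1 a2 c1 c2)//= subrr mulr0 oppr0 mulr0 add0r.
    rewrite (oE a1 a2 b1 b2 (x, _))//= => /esym E.
    rewrite -subr_ge0 -(@pmulr_rge0 _ (b1 - a1)) ?subr_gt0//.
    rewrite -(@pmulr_rge0 _ (c1 - a1)) ?subr_gt0// E mulr_ge0//; first by rewrite subr_ge0 ltW.
    exact: ltW.
  + move=> x /andP[bx xc]; have bc' : b1 < c1 by lra.
    have := bary'' (x, s a1 a2 c1 c2 * x + (a2 - s a1 a2 c1 c2 * a1)).
    rewrite (orient_swap (a1, a2)) (oE a1 a2 c1 c2)//= subrr mulr0 oppr0 mulr0 addr0.
    rewrite (oE b1 b2 c1 c2 (x, _))//= => /esym E.
    rewrite -subr_ge0 -(@pmulr_rge0 _ (c1 - b1)) ?subr_gt0//.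
    rewrite -(@pmulr_rge0 _ (c1 - a1)) ?subr_gt0// E mulr_ge0//; first by rewrite subr_ge0 ltW.
    exact: ltW.
  + move=> z [z1 [z2 z3]]; move: (bary' z) (bary'' z); rewrite /open_halfplane /= in z1 z2 z3 *. nra.
  + move=> z /andP[az zb]; have ab' : a1 < b1 by lra.
    rewrite -oE0// -oE1// /open_triangle /open_halfplane; split => [[-> [_ ->]]//|/andP[z1 z3]].
    split => //; split => //; have /= := bary z; nra.
  + move=> z /andP[bz zc]; have bc' : b1 < c1 by lra.
    rewrite -oE0// -oE1// /open_triangle /open_halfplane; split => [[_ [-> ->]]//|/andP[z2 z3]].
    split => //; have /= := bary z; nra.
- have ac : a1 < c1.
    rewrite lt_neqAle (le_trans ab bc) andbT; apply/eqP => E; move: D0.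
    have b1E : b1 = a1 by lra.
    by rewrite orientE b1E -E !subrr mul0r mulr0 subrr ltxx.
  have bary z : (z.1 - b1) * orient (a1, a2) (c1, c2) (b1, b2) =
     (a1 - b1) * orient (c1, c2) (b1, b2) z + (c1 - b1) * orient (b1, b2) (a1, a2) z.
    by rewrite /orient /=; ring.
  have bary' z : (z.1 - a1) * orient (a1, a2) (c1, c2) (b1, b2) =
     (b1 - a1) * orient (a1, a2) (c1, c2) z + (c1 - a1) * orient (b1, b2) (a1, a2) z.
    by rewrite /orient /=; ring.
  have bary'' z : (c1 - z.1) * orient (a1, a2) (c1, c2) (b1, b2) =
     (c1 - a1) * orient (c1, c2) (b1, b2) z + (c1 - b1) * orient (a1, a2) (c1, c2) z.
    by rewrite /orient /=; ring.
  rewrite (@area_two_strips (s a1 a2 c1 c2) (a2 - s a1 a2 c1 c2 * a1)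
     (s a1 a2 b1 b2) (a2 - s a1 a2 b1 b2 * a1)
     (s a1 a2 c1 c2) (a2 - s a1 a2 c1 c2 * a1)
     (s b1 b2 c1 c2) (b2 - s b1 b2 c1 c2 * b1) a1 b1 c1)//.
  + have ac0 : c1 - a1 != 0 by rewrite subr_eq0 gt_eqF.
    congr EFin; move: D0; rewrite !orientE /s.
    have [<-|nab] := eqVneq a1 b1.
      by move=> _; rewrite !subrr invr0 mulr0; field.
    have [->|nbc] := eqVneq b1 c1.
      by move=> _; rewrite !subrr invr0 mulr0; field.
    by move=> _; field; rewrite ac0 !subr_eq0 (eq_sym b1) nab (eq_sym c1) nbc.
  + exact: measurable_open_triangle.
  + move=> x /andP[ax xb]; have ab' : a1 < b1 by lra.
    have := bary' (x, s a1 a2 c1 c2 * x + (a2 - s a1 a2 c1 c2 * a1)).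
    rewrite (oE a1 a2 c1 c2 (x, _))//= subrr mulr0 mulr0 add0r (orient_swap (a1, a2)).
    rewrite (oE a1 a2 b1 b2 (x, _))//= -mulrN opprB => /esym E.
    rewrite -subr_ge0 -(@pmulr_rge0 _ (b1 - a1)) ?subr_gt0//.
    rewrite -(@pmulr_rge0 _ (c1 - a1)) ?subr_gt0// E mulr_ge0//; first by rewrite subr_ge0 ltW.
    exact: ltW.
  + move=> x /andP[bx xc]; have bc' : b1 < c1 by lra.
    have := bary'' (x, s a1 a2 c1 c2 * x + (a2 - s a1 a2 c1 c2 * a1)).
    rewrite (oE a1 a2 c1 c2 (x, _))//= subrr mulr0 mulr0 addr0 (orient_swap (b1, b2)).
    rewrite (oE b1 b2 c1 c2 (x, _))//= -mulrN opprB => /esym E.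
    rewrite -subr_ge0 -(@pmulr_rge0 _ (c1 - b1)) ?subr_gt0//.
    rewrite -(@pmulr_rge0 _ (c1 - a1)) ?subr_gt0// E mulr_ge0//; first by rewrite subr_ge0 ltW.
    exact: ltW.
  + move=> z [z1 [z2 z3]]; move: (bary' z) (bary'' z); rewrite /open_halfplane /= in z1 z2 z3 *. nra.
  + move=> z /andP[az zb]; have ab' : a1 < b1 by lra.
    rewrite -oE0// -oE1// /open_triangle /open_halfplane; split => [[-> [_ ->]]//|/andP[z1 z3]].
    split => //; split => //; have /= := bary z; nra.
  + move=> z /andP[bz zc]; have bc' : b1 < c1 by lra.
    rewrite -oE0// -oE1// /open_triangle /open_halfplane; split => [[-> [-> _]]//|/andP[z2 z3]].
    split => //; split => //; have /= := bary z; nra.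
Qed.

Lemma open_triangle_rot a b c : open_triangle b c a = open_triangle a b c :> set P2.
Proof. by rewrite /open_triangle setIA setIC. Qed.

(** Cyclic renaming keeps the triangle and puts its leftmost vertex first. *)
Lemma area_open_triangle (a b c : plane R) : 0 < orient a b c ->
  mu (open_triangle a b c) = (orient a b c / 2)%:E.
Proof.
case: a b c => [a1 a2] [b1 b2] [c1 c2].
set a := (a1, a2); set b := (b1, b2); set c := (c1, c2) => D0.
have D1 : 0 < orient b c a by rewrite orient_rot.
have D2 : 0 < orient c a b by rewrite -orient_rot.
have [ab|/ltW ba] := leP a1 b1; have [bc|/ltW cb] := leP b1 c1.
- exact: (area_open_triangle_sorted _ _ _ ab bc).1.
- have [ac|/ltW ca] := leP a1 c1; first exact: (area_open_triangle_sorted _ _ _ ac cb).2.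
  rewrite -[X in mu X]open_triangle_rot -open_triangle_rot -(orient_rot a) -(orient_rot b).
  exact: (area_open_triangle_sorted _ _ _ ca ab).1.
- have [ac|/ltW ca] := leP a1 c1.
    rewrite -[X in mu X]open_triangle_rot -(orient_rot a).
    exact: (area_open_triangle_sorted _ _ _ ba ac).2.
  rewrite -[X in mu X]open_triangle_rot -(orient_rot a).
  exact: (area_open_triangle_sorted _ _ _ bc ca).1.
- rewrite -[X in mu X]open_triangle_rot -open_triangle_rot -(orient_rot a) -(orient_rot b).
  exact: (area_open_triangle_sorted _ _ _ cb ba).2.
Qed.


End Triangle.

(** * Orientation and ears *)

Section Geometry.
Variable R : realType.
Local Notation mu := (area_measure R).
Local Notation P2 := (measurableTypeR R * measurableTypeR R)%type.
Implicit Types a b c x y z : plane R.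

Lemma orient_linear a b x y (s t : R) : s + t = 1 ->
  orient a b (s *: x + t *: y) = s * orient a b x + t * orient a b y.
Proof.
move=> st; have -> : s = 1 - t by rewrite -st addrK.
case: a b x y => [a1 a2] [b1 b2] [x1 x2] [y1 y2].
rewrite [_ + _](_ : _ = ((1 - t) * x1 + t * y1, (1 - t) * x2 + t * y2))//.
by rewrite !orientE; ring.
Qed.

Lemma orient_linear1 a b x y (s t : R) : s + t = 1 ->
  orient (s *: x + t *: y) a b = s * orient x a b + t * orient y a b.
Proof. by move=> st; rewrite -!(orient_rot _ a b) orient_linear. Qed.

Lemma orient_linear2 a b x y (s t : R) : s + t = 1 ->
  orient b (s *: x + t *: y) a = s * orient b x a + t * orient b y a.
Proof. by move=> st; rewrite !(orient_rot a b) orient_linear. Qed.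

Lemma orientxx a z : orient a a z = 0.
Proof. by rewrite /orient !subrr !mul0r subrr. Qed.

Lemma orientxyx a b : orient a b a = 0.
Proof. by rewrite orient_rot orientxx. Qed.

Lemma orientxyy a b : orient a b b = 0.
Proof. by rewrite -orient_rot orientxx. Qed.

Lemma orient_line_neq a b c : orient a b c != 0 -> a != b.
Proof. by apply: contra => /eqP ->; rewrite orientxx. Qed.

Lemma orient_swap23 a b c : orient a c b = - orient a b c.
Proof. by rewrite -orient_swap orient_rot. Qed.

Lemma area_line0 a b : a != b -> mu [set z : P2 | orient a b z = 0] = 0%E.
Proof.
case: a b => [a1 a2] [b1 b2] ab.
rewrite (_ : [set _ | _] = [set z : P2 |
    (a2 - b2) * z.1 + (b1 - a1) * z.2 = (b1 - a1) * a2 - (b2 - a2) * a1]).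
  by apply: area_line; move: ab; rewrite !subr_eq0 xpair_eqE negb_and orbC [b1 == _]eq_sym.
apply/seteqP; split => -[z1 z2] /=; rewrite orientE.
  by move=> /eqP; rewrite subr_eq0 => /eqP E; nra.
move=> E; apply/eqP; rewrite subr_eq0; apply/eqP; nra.
Qed.

Lemma measurable_line a b : measurable [set z : P2 | orient a b z = 0].
Proof.
have := measurable_orient a b => /(_ measurableT [set 0] (measurable_set1 _)).
by rewrite setTI.
Qed.

(* Half-open: disjoint from everything on the other side of the chord [ca], and
   empty when [orient a b c <= 0]. *)
Definition ear a b c : set P2 :=
  halfplane a b `&` (halfplane b c `&` open_halfplane c a).

Lemma measurable_ear a b c : measurable (ear a b c).
Proof.
by apply: measurableI; [|apply: measurableI];
  [exact: measurable_halfplane..|exact: measurable_open_halfplane].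
Qed.

Lemma ear_orient_gt0 a b c (z : P2) : ear a b c z -> 0 < orient a b c.
Proof. by case=> z1 [z2 z3]; rewrite -(orient_sum a b c z) ltr_wpDl// addr_ge0. Qed.

Lemma area_ear a b c : 0 <= orient a b c -> mu (ear a b c) = (orient a b c / 2)%:E.
Proof.
rewrite le_eqVlt => /predU1P[D0|D0].
  rewrite -D0 mul0r (_ : ear a b c = set0) ?measure0// -subset0 => z /ear_orient_gt0.
  by rewrite -D0 ltxx.
rewrite -area_open_triangle//; apply/eqP; rewrite eq_le; apply/andP; split; last first.
  apply: le_measure; rewrite ?inE; [exact: measurable_open_triangle|exact: measurable_ear|].
  by move=> z [z1 [z2 z3]]; split; [exact: ltW|split => //; exact: ltW].
have ab : a != b by apply: (@orient_line_neq _ _ c); rewrite gt_eqF.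
have bc : b != c by apply: (@orient_line_neq _ _ a); rewrite orient_rot gt_eqF.
apply: (@le_trans _ _ (mu (open_triangle a b c `|`
   ([set z | orient a b z = 0] `|` [set z | orient b c z = 0])))).
  apply: le_measure; rewrite ?inE.
  - exact: measurable_ear.
  - apply: measurableU; first exact: measurable_open_triangle.
    by apply: measurableU; exact: measurable_line.
  - move=> z [/=]; rewrite /halfplane /= le_eqVlt => /predU1P[z1 _|z1]; first by right; left.
    move=> []; rewrite /halfplane /= le_eqVlt => /predU1P[z2 _|z2 z3]; first by right; right.
    by left; split.
have m1 := measurable_line a b; have m2 := measurable_line b c.
have -> : mu (open_triangle a b c) = (mu (open_triangle a b c) +
    (mu [set z : P2 | orient a b z = 0%R] + mu [set z : P2 | orient b c z = 0%R]))%E.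
  by rewrite !area_line0// !adde0.
apply: le_trans (measureU2 _ _ _) _ => //.
- exact: measurable_open_triangle.
- exact: measurableU.
- by rewrite leeD2l//; exact: measureU2.
Qed.

Lemma convex_setP (A : set (plane R)) :
  @convex_set R (plane R) A <->
  forall x y t, A x -> A y -> 0 <= t <= 1 -> A (t *: x + (1 - t) *: y).
Proof.
split=> [cA x y t Ax Ay t01|H x y l]; last first.
  by rewrite !inE => Ax Ay; apply: H => //; apply/andP; split.
have t1 : (t \in `[0, 1])%R by rewrite in_itv.
have := cA x y (@Itv01 R t (proj1 (andP t01)) (proj2 (andP t01))) (mem_set Ax) (mem_set Ay).
by rewrite inE.
Qed.

Lemma convex_halfplane a b : @convex_set R (plane R) (halfplane a b).
Proof.
apply/convex_setP => x y t x0 y0 /andP[t0 t1].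
rewrite /halfplane /= orient_linear ?subrKC//.
by rewrite addr_ge0// mulr_ge0// subr_ge0.
Qed.

Lemma bary_solve (D z a b c x y w : R) : D != 0 -> z * D = a * x + b * y + c * w ->
  z = a / D * x + (b / D * y + c / D * w).
Proof. by move=> D0 E; apply: (mulIf D0); rewrite E; field. Qed.

(** The barycentric coordinates of [z] are its three orientations divided by that of the triangle.
    Convexity combines two points at a time, so [z] is placed between [a] and a point of the side
    [bc]. *)
Lemma convex_triangle (A : set (plane R)) a b c z : @convex_set R (plane R) A ->
  A a -> A b -> A c -> 0 < orient a b c ->
  0 <= orient a b z -> 0 <= orient b c z -> 0 <= orient c a z -> A z.
Proof.
move=> /convex_setP cA Aa Ab Ac D0 z1 z2 z3.
pose D := orient a b c.
pose p := orient b c z / D; pose q := orient c a z / D; pose r := orient a b z / D.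
have Dn : D != 0 by rewrite gt_eqF.
have p0 : 0 <= p by rewrite divr_ge0// ltW.
have q0 : 0 <= q by rewrite divr_ge0// ltW.
have r0 : 0 <= r by rewrite divr_ge0// ltW.
have pqr : p + q + r = 1.
  by rewrite /p /q /r -!mulrDl addrC addrA orient_sum divff.
have zE : z = p *: a + (q *: b + r *: c).
  have H1 : z.1 * D = orient b c z * a.1 + orient c a z * b.1 + orient a b z * c.1.
    rewrite /D; move: a b c z {Aa Ab Ac D0 z1 z2 z3 D p q r Dn p0 q0 r0 pqr} =>
      [a1 a2] [b1 b2] [c1 c2] [z1 z2]; rewrite !orientE /=; ring.
  have H2 : z.2 * D = orient b c z * a.2 + orient c a z * b.2 + orient a b z * c.2.
    rewrite /D; move: a b c z {Aa Ab Ac D0 z1 z2 z3 D p q r Dn p0 q0 r0 pqr H1} =>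
      [a1 a2] [b1 b2] [c1 c2] [z1 z2]; rewrite !orientE /=; ring.
  have E1 : z.1 = p * a.1 + (q * b.1 + r * c.1).
    exact: bary_solve.
  have E2 : z.2 = p * a.2 + (q * b.2 + r * c.2).
    exact: bary_solve.
  by rewrite [LHS]surjective_pairing E1 E2.
clearbody p q r; have [qr0|qr0] := eqVneq (q + r) 0.
  have qE : q = 0 by lra.
  have rE : r = 0 by lra.
  have pE : p = 1 by lra.
  by rewrite zE pE qE rE !scale0r !addr0 scale1r.
have -> : z = p *: a + (1 - p) *: ((q / (q + r)) *: b + (1 - q / (q + r)) *: c).
  rewrite scalerDr !scalerA zE; congr (_ + (_ *: _ + _ *: _)).
    have -> : 1 - p = q + r by lra.
    by field.
  have -> : 1 - p = q + r by lra.
  by field.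
have qr1 : 0 < q + r by rewrite lt_neqAle eq_sym qr0 addr_ge0.
apply: (cA) => //; last by apply/andP; split => //; lra.
apply: cA => //; apply/andP; split; first exact: divr_ge0 (ltW qr1).
by rewrite ler_pdivrMr// mul1r lerDl.
Qed.

Lemma ear_sub (A : set (plane R)) a b c : @convex_set R (plane R) A ->
  A a -> A b -> A c -> ear a b c `<=` A.
Proof.
move=> cA Aa Ab Ac z ez; have := ear_orient_gt0 ez; case: ez => z1 [z2 z3] D0.
by apply: (convex_triangle cA Aa Ab Ac D0) => //; exact: ltW.
Qed.

Lemma region_vertex n (v : 'I_n -> plane R) i : region v (v i).
Proof. by move=> A [_]; apply; exists i. Qed.

Lemma convex_region n (v : 'I_n -> plane R) : @convex_set R (plane R) (region v).
Proof.
apply/convex_setP => x y t rx ry t01 A [cA vA].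
by move/convex_setP: (cA) => /(_ x y t); apply => //; [exact: rx|exact: ry].
Qed.

Lemma region_sub n (v : 'I_n -> plane R) (A : set (plane R)) :
  @convex_set R (plane R) A -> (forall i, A (v i)) -> region v `<=` A.
Proof. by move=> cA vA z; apply; split => // _ [i _ <-]. Qed.

End Geometry.

Arguments region_vertex {R n} v i.
Arguments convex_region {R n} v.
Arguments convex_halfplane {R} a b.

(** * Convex polygons *)

Section Polygon.
Variable R : realType.
Local Notation mu := (area_measure R).
Local Notation P2 := (measurableTypeR R * measurableTypeR R)%type.

Lemma val_ordS n (i : 'I_n) : val (ordS i) = if i.+1 == n then 0%N else i.+1.
Proof.
rewrite /=; case: eqP => [->|/eqP ne]; first by rewrite modnn.
by rewrite modn_small// ltn_neqAle ne ltn_ord.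
Qed.

Lemma val_iter_ordS n (i : 'I_n) r : val (iter r (@ordS n) i) = ((i + r) %% n)%N.
Proof.
elim: r => [|r IH]; first by rewrite addn0 modn_small.
by rewrite iterS /= IH -addn1 modnDml addn1 addnS.
Qed.

Lemma iter_ordS_neq n (i : 'I_n) r : (0 < r < n)%N -> iter r (@ordS n) i != i.
Proof.
move=> /andP[r0 rn]; apply/eqP => /(congr1 val); rewrite val_iter_ordS => E.
have : ((i + r) %% n == (i + 0) %% n)%N by rewrite E addn0 modn_small.
by rewrite eqn_modDl mod0n modn_small// gtn_eqF.
Qed.

Lemma iter_ordS_id n (i : 'I_n) : iter n (@ordS n) i = i.
Proof. by apply: val_inj; rewrite val_iter_ordS modnDr modn_small. Qed.

(** Unlike the edgewise condition of [convex_ngon], this one passes directly to subsequences of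
    vertices. *)
Definition ccw n (v : 'I_n -> plane R) :=
  forall i j k : 'I_n, (i < j < k)%N -> 0 < orient (v i) (v j) (v k).

Lemma ccw_convex_ngon n (v : 'I_n -> plane R) : (3 <= n)%N -> ccw v -> convex_ngon v.
Proof.
move=> n3 cv; split => // i k ki kSi.
have vS := val_ordS i; have ik : (val k != val i) by [].
have iSk : (val k != val (ordS i)) by [].
move: vS iSk; case: eqP => [iE -> k0|ne SE iSk].
- rewrite -(orient_rot (v i)) -(orient_rot (v (ordS i))).
  rewrite -(orient_rot (v k)) -(orient_rot (v i)).
  apply: cv; rewrite val_ordS iE eqxx lt0n k0 /= ltn_neqAle ik -ltnS iE; exact: ltn_ord.
- have [ki'|ik'|/val_inj/eqP] := ltngtP k i; last by rewrite (negPf ki).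
  + rewrite (orient_rot (v k)); apply: cv; rewrite ki' SE /=; exact: ltnSn.
  + apply: cv; rewrite SE /= ltnSn /= ltn_neqAle ik' andbT eq_sym; by rewrite SE in iSk.
Qed.

(** Induction on the last index, with [l] its predecessor. Seen from [v i], the later vertices lie
    on one side of the edge leaving [v i], so their angular order is transitive: [j] before [l] and
    [l] before [k] give [j] before [k]. *)
Lemma convex_ngon_ccw n (v : 'I_n -> plane R) : convex_ngon v -> ccw v.
Proof.
move=> [n3 cv] i j.
suff H m : forall k : 'I_n, k = m :> nat -> (i < j < k)%N -> 0 < orient (v i) (v j) (v k).
  by move=> k; exact: H.
elim: m => [k ->|m IH k km /andP[ij jk]]; first by rewrite ltn0 andbF.
have kn : (m < n)%N by rewrite -ltnS -km; apply: leq_trans (ltn_ord k) (leqnSn _).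
pose l := Ordinal kn.
have lk : ordS l = k by apply: val_inj; rewrite val_ordS -km (ltn_eqF (ltn_ord k)).
have vne (a b : 'I_n) : (a < b)%N -> a != b by move=> ab; rewrite -val_eqE ltn_eqF.
have il : (i < l)%N by rewrite /=; lia.
have ilk : 0 < orient (v i) (v l) (v k).
  rewrite -(orient_rot (v i)) -lk; apply: cv; first exact: vne.
  by rewrite lk; apply: vne; rewrite km; lia.
have [->//|jl] := eqVneq j l.
have jl' : (j < l)%N.
  have : (j : nat) != m by [].
  by rewrite /= in jl *; lia.
have ijl := IH l erefl (introT andP (conj ij jl')).
have Si : ordS i = i.+1 :> nat by rewrite [LHS]val_ordS ltn_eqF//; have := ltn_ord j; lia.
have e (w : 'I_n) : (i.+1 < w)%N -> 0 < orient (v i) (v (ordS i)) (v w).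
  move=> iw; apply: cv; first by rewrite eq_sym; apply: vne; lia.
  by rewrite eq_sym; apply: vne; rewrite Si.
have [iSj|iSj] := eqVneq (ordS i) j.
  by rewrite -iSj; apply: e; rewrite -Si iSj.
have iSj' : (i.+1 < j)%N.
  have : (ordS i : nat) != j by [].
  by rewrite Si; lia.
have ej := e j iSj'; have el := e l (ltn_trans iSj' jl').
have ek := e k (ltn_trans iSj' jk).
rewrite -(pmulr_rgt0 _ el).
(* The three-term Plücker relation for the directions from [v i] to the four other points. *)
have -> : orient (v i) (v (ordS i)) (v l) * orient (v i) (v j) (v k) =
  orient (v i) (v (ordS i)) (v j) * orient (v i) (v l) (v k) +
  orient (v i) (v (ordS i)) (v k) * orient (v i) (v j) (v l).
  move: (v i) (v (ordS i)) (v j) (v k) (v l) => [? ?] [? ?] [? ?] [? ?] [? ?].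
  by rewrite !orientE; ring.
by rewrite addr_gt0// mulr_gt0.
Qed.

Lemma convex_edge_ge0 n (v : 'I_n -> plane R) i k : convex_ngon v ->
  0 <= orient (v i) (v (ordS i)) (v k).
Proof.
move=> [_ cv].
have [->|ki] := eqVneq k i; first by rewrite orientxyx.
have [->|kSi] := eqVneq k (ordS i); first by rewrite orientxyy.
by apply: ltW; exact: cv.
Qed.

Lemma region_halfplane n (v : 'I_n -> plane R) i z : convex_ngon v ->
  region v z -> 0 <= orient (v i) (v (ordS i)) z.
Proof.
move=> cv rz; apply: (region_sub (convex_halfplane (v i) (v (ordS i))) _ rz) => k.
exact: convex_edge_ge0.
Qed.

(** Triangulation by the diagonals from [v i]. The orientation of [z] with respect to the [r]-th
    diagonal is nonnegative at the first edge and nonpositive at the last one, which is traversed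
    backwards; the first change of sign locates the triangle. *)
Lemma fan n (v : 'I_n -> plane R) (i : 'I_n) z : (3 <= n)%N ->
  (forall k, 0 <= orient (v k) (v (ordS k)) z) ->
  exists k, [/\ k != i, ordS k != i, 0 <= orient (v i) (v k) z,
    0 <= orient (v k) (v (ordS k)) z & 0 <= orient (v (ordS k)) (v i) z].
Proof.
move=> n3 hz.
pose D r := orient (v i) (v (iter r (@ordS n) i)) z.
have last_le0 : (0 < n.-2)%N && (D n.-2.+1 <= 0).
  apply/andP; split; first by case: n n3 {v i z hz D} => [|[|[|]]].
  rewrite /D -oppr_ge0 -orient_swap.
  have := hz (iter n.-1 (@ordS n) i); rewrite -iterS.
  have -> : n.-1.+1 = n by case: n n3 {v i z hz D}.
  have -> : n.-2.+1 = n.-1 by case: n n3 {v i z hz D} => [|[|]].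
  by rewrite iter_ordS_id.
have ex : exists r, (0 < r)%N && (D r.+1 <= 0) by exists n.-2.
case: (ex_minnP ex) => r /andP[r0 Dr] rmin.
have rn : (r.+1 < n)%N.
  by have := rmin _ last_le0; case: n n3 {v i z hz D last_le0 ex rmin Dr} => [|[|[|]]].
exists (iter r (@ordS n) i); split.
- by apply: iter_ordS_neq; rewrite r0 (ltn_trans (ltnSn r)).
- by rewrite -iterS; apply: iter_ordS_neq; rewrite rn.
- case: r r0 Dr rmin rn => [//|[|r]] _ Dr rmin rn; first exact: hz.
  rewrite leNgt; apply/negP => lt0.
  by have := rmin r.+1; rewrite /= (ltW lt0) => /(_ isT); rewrite ltnn.
- exact: hz.
- by rewrite -iterS orient_swap oppr_ge0.
Qed.

(** The triangle found by [fan] lies in the hull. The description by half-planes makes the region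
    measurable and separates any point outside it by an edge. *)
Lemma region_convex_ngon n (v : 'I_n -> plane R) : convex_ngon v ->
  region v = [set z | forall k, 0 <= orient (v k) (v (ordS k)) z].
Proof.
move=> cv; apply/seteqP; split => [z rz k|z hz]; first exact: region_halfplane.
have n3 := cv.1.
have i : 'I_n by exists 0%N; case: n n3 {v cv hz}.
have [k [ki kSi z1 z2 z3]] := fan i n3 hz.
apply: (convex_triangle (convex_region v) (region_vertex v i) (region_vertex v k)
  (region_vertex v (ordS k))) => //.
by rewrite -(orient_rot (v i)); apply: cv.2; rewrite eq_sym.
Qed.

Lemma measurable_region n (v : 'I_n -> plane R) : convex_ngon v ->
  measurable (region v : set P2).
Proof.
move=> cv; rewrite region_convex_ngon//.
rewrite (_ : [set _ | _] = \bigcap_(k in setT) halfplane (v k) (v (ordS k))); last first.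
  by apply/seteqP; split => [z h k _|z h k]; exact: h.
apply: fin_bigcap_measurable => // k _; exact: measurable_halfplane.
Qed.

Lemma area_region_lty n (v : 'I_n -> plane R) : convex_ngon v ->
  (mu (region v) < +oo)%E.
Proof.
move=> cv.
pose M := \sum_i (`|(v i).1| + `|(v i).2|).
have box : region v `<=` (`[- M, M] `*` `[- M, M]).
  apply: region_sub => [|i].
    apply/convex_setP => x y t [] /=; rewrite !in_itv /= => /andP[x1 x2] /andP[x3 x4].
    move=> [/andP[y1 y2] /andP[y3 y4]] /andP[t0 t1].
    have bd (a b : R) : - M <= a -> a <= M -> - M <= b -> b <= M ->
        - M <= t * a + (1 - t) * b <= M.
      by move=> *; apply/andP; split; nra.
    by split; apply: bd.
  have Mi : `|(v i).1| + `|(v i).2| <= M.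
    rewrite /M (bigD1 i)//= lerDl sumr_ge0// => k _; exact: addr_ge0.
  split; rewrite /= in_itv /= -ler_norml; apply: le_trans Mi; first by rewrite lerDl.
  by rewrite lerDr.
apply: (@le_lt_trans _ _ (mu (`[- M, M] `*` `[- M, M]))).
  apply: le_measure => //; rewrite inE; first exact: measurable_region.
  exact: measurableX.
rewrite [ltLHS](_ : _ = (@lebesgue_measure R `[(- M)%R, M] *
  @lebesgue_measure R `[(- M)%R, M])%E); last exact: product_measure1E.
rewrite lebesgue_measure_itv /=.
by case: ifP => _; rewrite -?EFinB -?EFinM ?mule0 ltry.
Qed.

Lemma area_region_fin n (v : 'I_n -> plane R) : convex_ngon v ->
  mu (region v) \is a fin_num.
Proof.
move=> cv; rewrite ge0_fin_numE ?measure_ge0//; exact: area_region_lty.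
Qed.

(** Some vertex of [w] lies strictly beyond an edge of [v]. The triangle on that edge with this apex
    has positive area, lies in the region of [w] and misses that of [v]. *)
Lemma area_region_lt m n (v : 'I_m -> plane R) (w : 'I_n -> plane R) :
  convex_ngon v -> convex_ngon w -> region v `<=` region w ->
  region v <> region w -> (mu (region v) < mu (region w))%E.
Proof.
move=> cv cw vw nvw.
have [k nk] : exists k, ~ region v (w k).
  apply: contrapT => /forallNP H; apply: nvw; apply/seteqP; split => //.
  by apply: region_sub; [exact: convex_region|move=> k; have := H k; exact: contrapT].
have [j] : exists j, orient (v j) (v (ordS j)) (w k) < 0.
  apply: contrapT => /forallNP H; apply: nk; rewrite region_convex_ngon// => j.
  by rewrite leNgt; apply/negP; exact: H.
rewrite -oppr_gt0 -orient_swap => D0.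
set a := v (ordS j) in D0; set b := v j in D0; set c := w k in D0.
have D1 : 0 < orient b c a by rewrite orient_rot.
have D1' : 0 < orient c a b by rewrite -orient_rot.
have dis : region v `&` (ear b c a : set P2) = set0.
  rewrite -subset0 => z [rz [_ [_]]]; rewrite /open_halfplane /= orient_swap oppr_gt0.
  by rewrite ltNge region_halfplane.
have earw : (ear b c a : set P2) `<=` region w.
  apply: ear_sub; [exact: convex_region|exact: (vw _ (region_vertex v _))|exact: region_vertex|].
  exact: (vw _ (region_vertex v _)).
have mE := measurable_ear b c a; have mv := measurable_region cv.
apply: (@lt_le_trans _ _ (mu (region v) + mu (ear b c a))).
  rewrite area_ear ?ltW// lteDl ?area_region_fin//.
  by rewrite lte_fin divr_gt0.
rewrite -[leLHS]measureU//; apply: le_measure; rewrite ?inE.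
- exact: measurableU.
- exact: measurable_region.
- by rewrite subUset.
Qed.

Lemma region_eq_of_area m n (v : 'I_m -> plane R) (w : 'I_n -> plane R) :
  convex_ngon v -> convex_ngon w -> region v `<=` region w ->
  (mu (region w) <= mu (region v))%E -> region v = region w.
Proof.
move=> cv cw vw wv; apply: contrapT => /(area_region_lt cv cw vw).
by rewrite ltNge wv.
Qed.

End Polygon.

(** * Polygons inscribed with minimum area: three consecutive used vertices *)

Section Necessity.
Variable R : realType.
Local Notation mu := (area_measure R).
Local Notation P2 := (measurableTypeR R * measurableTypeR R)%type.

Lemma val_ord_pred n (i : 'I_n) :
  ord_pred i = (if (i == 0 :> nat)%N then n.-1 else i.-1) :> nat.
Proof.
have n0 : (0 < n)%N by apply: leq_ltn_trans (ltn_ord i).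
rewrite /=; case: eqP => [->|/eqP i0]; first by rewrite add0n modn_small// prednK.
have -> : ((i + n).-1 = i.-1 + n)%N by lia.
by rewrite modnDr modn_small// (leq_ltn_trans (leq_pred _)).
Qed.

Lemma ccw_cyclic n (v : 'I_n -> plane R) (i j k : 'I_n) : convex_ngon v ->
  [|| (i < j < k)%N, (j < k < i)%N | (k < i < j)%N] ->
  0 < orient (v i) (v j) (v k).
Proof.
move=> /convex_ngon_ccw cv /or3P[h|h|h]; first exact: cv.
  by rewrite -orient_rot; exact: cv.
by rewrite orient_rot; exact: cv.
Qed.

Lemma convex_chord n (v : 'I_n -> plane R) (i k : 'I_n) : convex_ngon v ->
  k != i -> 0 <= orient (v (ord_pred i)) (v (ordS i)) (v k).
Proof.
move=> cv ki.
have [->|kp] := eqVneq k (ord_pred i); first by rewrite orientxyx.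
have [->|ks] := eqVneq k (ordS i); first by rewrite orientxyy.
apply/ltW/ccw_cyclic => //.
have n3 := cv.1; have ni := ltn_ord i; have nk := ltn_ord k.
move: ki kp ks; rewrite -!val_eqE [val (ordS i)]val_ordS [val (ord_pred i)]val_ord_pred.
rewrite [nat_of_ord (ordS i)]val_ordS val_ord_pred /=.
by case: ifP => i0; case: ifP => iN; lia.
Qed.

Lemma ord_pred_neqS n (i : 'I_n) : (3 <= n)%N -> ord_pred i != ordS i.
Proof.
move=> n3; rewrite -val_eqE [val (ordS i)]val_ordS [val (ord_pred i)]val_ord_pred.
by have := ltn_ord i; case: ifP => i0; case: ifP => iN; lia.
Qed.

Lemma ordS_neq n (i : 'I_n) : (2 <= n)%N -> ordS i != i.
Proof. by move=> n2; apply: (@iter_ordS_neq _ i 1). Qed.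

Lemma ord_pred_neq n (i : 'I_n) : (2 <= n)%N -> ord_pred i != i.
Proof. by move=> n2; have := ordS_neq (ord_pred i) n2; rewrite ord_predK eq_sym. Qed.

Lemma convex_ear_gt0 n (v : 'I_n -> plane R) (i : 'I_n) : convex_ngon v ->
  0 < orient (v (ord_pred i)) (v i) (v (ordS i)).
Proof.
move=> cv; rewrite -{2}(ord_predK i); apply: cv.2; rewrite ?ord_predK.
  by rewrite eq_sym ord_pred_neqS// cv.1.
by apply: ordS_neq; apply: leq_trans cv.1.
Qed.

Lemma convex_ngon_inj n (v : 'I_n -> plane R) : convex_ngon v -> injective v.
Proof.
move=> [n3 cv] i j vij; apply/eqP; apply: contraT => ij.
have [jS|jS] := eqVneq j (ordS i).
  have : 0 < orient (v j) (v (ordS j)) (v i).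
    by apply: cv => //; rewrite jS eq_sym; apply: (@iter_ordS_neq _ i 2).
  by rewrite vij orientxyx ltxx.
have : 0 < orient (v i) (v (ordS i)) (v j) by apply: cv; rewrite // eq_sym.
by rewrite vij orientxyx ltxx.
Qed.

Lemma side_orient n (p : 'I_n -> plane R) k x : side p k x ->
  orient (p k) (p (ordS k)) x = 0.
Proof. by move=> [t _ <-]; rewrite orient_linear ?subrK// orientxyx orientxyy !mulr0 addr0. Qed.

Lemma side_vertex n (p : 'I_n -> plane R) k j : convex_ngon p ->
  side p k (p j) -> j = k \/ j = ordS k.
Proof.
move=> [_ cp] /side_orient E.
have [->|jk] := eqVneq j k; first by left.
have [->|jSk] := eqVneq j (ordS k); first by right.
by have := cp k j jk jSk; rewrite E ltxx.
Qed.

Lemma side_start n (p : 'I_n -> plane R) k : side p k (p k).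
Proof. by exists 0; rewrite /= ?in_itv /= ?lexx ?ler01// subr0 scale1r scale0r addr0. Qed.

Lemma side_end n (p : 'I_n -> plane R) k : side p k (p (ordS k)).
Proof. by exists 1; rewrite /= ?in_itv /= ?lexx ?ler01// subrr scale1r scale0r add0r. Qed.

(** A linear form that is nonnegative at both ends of a side and zero inside it vanishes at both
    ends. Thus a vertex of [q] inside a side serves no other side and is free to move along its
    own. *)
Lemma side_relint n (p : 'I_n -> plane R) i k t : convex_ngon p -> 0 < t < 1 ->
  side p k ((1 - t) *: p i + t *: p (ordS i)) -> k = i.
Proof.
move=> cp /andP[t0 t1] /side_orient; rewrite orient_linear ?subrK// => E.
apply/eqP; apply: contraT => ki.
have ge1 := convex_edge_ge0 k i cp; have ge2 := convex_edge_ge0 k (ordS i) cp.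
have [iS|iS] := eqVneq i (ordS k).
  have : 0 < orient (p k) (p (ordS k)) (p (ordS i)).
    apply: cp.2; rewrite iS; first by apply: (@iter_ordS_neq _ k 2); rewrite /= cp.1.
    by rewrite -iS; apply: ordS_neq; apply: leq_trans cp.1.
  by nra.
have : 0 < orient (p k) (p (ordS k)) (p i) by apply: cp.2 => //; rewrite eq_sym.
by nra.
Qed.

Lemma convex_ngon_delete m (q : 'I_m.+1 -> plane R) (b : 'I_m.+1) : (3 <= m)%N ->
  convex_ngon q -> convex_ngon (q \o lift b).
Proof.
move=> m3 /convex_ngon_ccw cq; apply: ccw_convex_ngon => // i j k /andP[ij jk].
by apply: cq; rewrite /= !ltnNge !leq_bump2 -!ltnNge ij jk.
Qed.

Lemma area_delete m (q : 'I_m.+1 -> plane R) (b : 'I_m.+1) : (3 <= m)%N ->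
  convex_ngon q -> (mu (region (q \o lift b)) < mu (region q))%E.
Proof.
move=> m3 cq; have cq' := convex_ngon_delete b m3 cq.
have sub : region (q \o lift b) `<=` region q.
  by apply: region_sub => [|k]; [exact: convex_region|exact: region_vertex].
apply: area_region_lt => // E.
have : halfplane (q (ord_pred b)) (q (ordS b)) (q b).
  have : region (q \o lift b) (q b) by rewrite E; exact: region_vertex.
  apply: (region_sub (convex_halfplane (q (ord_pred b)) (q (ordS b)))) => k.
  by apply: convex_chord => //; rewrite eq_sym neq_lift.
by rewrite /halfplane /= orient_swap23 oppr_ge0 leNgt convex_ear_gt0.
Qed.

Lemma min_area_le n m (p : 'I_n -> plane R) (q : 'I_m -> plane R) m' (q' : 'I_m' -> plane R) :
  min_area_inscribed p q -> inscribed p q' -> (mu (region q) <= mu (region q'))%E.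
Proof.
move=> [_ E] iq'; have -> : mu (region q) = ereal_inf (inscribed_areas p) by [].
by apply: ereal_inf_lbound; exists m', q'.
Qed.

(** A side containing the middle vertex also contains one of the other two. A polygon remains after
    the deletion because [q] has a fourth vertex: since [n >= 5], the side starting three steps
    after [i] contains none of the three. *)
Lemma min_area_three_vertices n m (p : 'I_n -> plane R) (q : 'I_m -> plane R) (i : 'I_n) :
  (5 <= n)%N -> convex_ngon p -> min_area_inscribed p q ->
  range q (p i) -> range q (p (ordS i)) -> range q (p (ordS (ordS i))) -> False.
Proof.
move=> n5 cp minq [a _ qa] [b _ qb] [c _ qc].
have [[cq sq] _] := minq.
have S r r' : (r < r' < r + n)%N -> iter r (@ordS n) i <> iter r' (@ordS n) i.
  move=> rr E.
  have : iter (r' - r) (@ordS n) (iter r (@ordS n) i) != iter r (@ordS n) i.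
    by apply: iter_ordS_neq; lia.
  by rewrite -iterD subnK ?E ?eqxx//; lia.
have [d sd] := sq (iter 3 (@ordS n) i).
have pne (x y : 'I_m) (u w : nat) : q x = p (iter u (@ordS n) i) ->
    q y = p (iter w (@ordS n) i) -> (u < w < u + n)%N -> x != y.
  move=> xu yw uw; apply/eqP => xy; apply: (S _ _ uw).
  by apply: (convex_ngon_inj cp); rewrite -xu -yw xy.
have dne (x : 'I_m) (u : nat) : q x = p (iter u (@ordS n) i) -> (u < 3)%N -> x != d.
  move=> xu u3; apply/eqP => xd; move: sd; rewrite -xd xu => /(side_vertex cp)[|].
    by apply: S; lia.
  by rewrite -iterS; apply: S; lia.
have m4 : (4 <= m)%N.
  have u : uniq [:: a; b; c; d].
    rewrite /= !inE !negb_or andbT.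
    rewrite (pne a b 0%N 1%N)//= ?(pne a c 0%N 2%N)//= ?(pne b c 1%N 2%N)//=; try lia.
    by rewrite (dne a 0%N)// (dne b 1%N)// (dne c 2%N).
  have := max_card (mem [:: a; b; c; d]).
  by rewrite (card_uniqP u) card_ord.
case: m m4 q minq a qa b qb c qc cq sq d sd pne dne => // m m3 q minq a qa b qb c qc cq sq d _ pne _.
have inq : inscribed p (q \o lift b).
  split; first exact: convex_ngon_delete.
  move=> k; have [j sj] := sq k.
  suff [j' jb' sj'] : exists2 j', j' != b & side p k (q j').
    have := unlift_some (h := b) (i := j'); rewrite eq_sym => /(_ jb')[l lE _].
    by exists l; rewrite /= -lE.
  have [jb|jb] := eqVneq j b; last by exists j.
  move: sj; rewrite jb qb => /(side_vertex cp)[kE|/ordS_inj kE].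
    exists c; last by rewrite qc -kE; exact: side_end.
    by rewrite eq_sym; apply: (pne _ _ 1%N 2%N); rewrite //; lia.
  exists a; last by rewrite qa -kE; exact: side_start.
  by apply: (pne _ _ 0%N 1%N); rewrite //; lia.
by have := min_area_le minq inq; rewrite leNgt area_delete.
Qed.

End Necessity.

(** * Two consecutive unused vertices *)

Section Perturbation.
Variable R : realType.
Local Notation mu := (area_measure R).
Local Notation P2 := (measurableTypeR R * measurableTypeR R)%type.

(** One radius for finitely many strict inequalities: [1 / (1 + S)], where [S] sums the ratios
    [|v k| / |u k|]. The absolute value of [u k] keeps every term nonnegative, whatever the sign of
    [u k]. *)
Lemma uniform_perturbation (I : finType) (u v : I -> R) :
  exists2 d, 0 < d <= 1 &
    forall k t, 0 < u k -> `|t| <= d -> 0 < u k + t * v k.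
Proof.
pose S := \sum_k `|v k| / `|u k|.
have S0 : 0 <= S by apply: sumr_ge0 => k _; exact: divr_ge0.
have S1 : 0 < 1 + S by rewrite ltr_wpDr.
exists (1 + S)^-1.
  by rewrite invr_gt0 S1 /= invf_le1// lerDl.
move=> k t uk td.
have Sk : `|v k| / u k <= S.
  rewrite /S (bigD1 k)//= (gtr0_norm uk) lerDl sumr_ge0// => l _; exact: divr_ge0.
have vk : `|v k| <= S * u k by rewrite -ler_pdivrMr.
have tv : `|t| * `|v k| < u k.
  apply: (@le_lt_trans _ _ ((1 + S)^-1 * (S * u k))); first exact: ler_pM.
  by rewrite mulrA gtr_pMl// mulrC ltr_pdivrMr// mul1r ltrDr.
by move: tv; rewrite -normrM ltr_norml => /andP[h _]; lra.
Qed.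

(** The three-term Plücker relation for directions from [a]. When [z] is on the line [ac] the right
    side vanishes, so the orientations of [z] with respect to [ax] and [ay] are proportional. *)
Lemma orient_pluecker (a c x y z : plane R) :
  orient a x z * orient a y c - orient a y z * orient a x c =
  orient a z c * orient a x y.
Proof. by move: a c x y z => [? ?] [? ?] [? ?] [? ?] [? ?]; rewrite !orientE; ring. Qed.

Definition move_vertex m (q : 'I_m -> plane R) (j : 'I_m) (x : plane R) (k : 'I_m) :=
  if k == j then x else q k.

(** The moving vertex occurs at most once in each orientation required of a convex polygon, which is
    therefore affine in [t], with slope [v]: its value at [t = 1] minus its value at [t = 0]. *)
Lemma move_vertex_convex m (q : 'I_m -> plane R) (j : 'I_m) (y : plane R) :
  convex_ngon q ->
  exists2 d, 0 < d <= 1 & forall t, `|t| <= d ->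
    convex_ngon (move_vertex q j ((1 - t) *: q j + t *: y)).
Proof.
move=> cq; have [m3 cq'] := cq.
pose u (ik : 'I_m * 'I_m) := orient (q ik.1) (q (ordS ik.1)) (q ik.2).
pose q1 := move_vertex q j y.
pose v (ik : 'I_m * 'I_m) := orient (q1 ik.1) (q1 (ordS ik.1)) (q1 ik.2) - u ik.
have [d d01 dP] := uniform_perturbation u v.
exists d => // t td; split => // i k ki kSi.
have uik : 0 < u (i, k) by exact: cq'.
have := dP (i, k) t uik td.
suff -> : u (i, k) + t * v (i, k) = orient
   (move_vertex q j ((1 - t) *: q j + t *: y) i)
   (move_vertex q j ((1 - t) *: q j + t *: y) (ordS i))
   (move_vertex q j ((1 - t) *: q j + t *: y) k) by [].
rewrite /v /= /u /q1 /= /move_vertex.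
have Si : ordS i != i by apply: ordS_neq; apply: leq_trans m3.
have [ij|ij] := eqVneq i j.
  rewrite -ij (negPf Si) (negPf ki) orient_linear1 ?subrK//; ring.
have [Sij|Sij] := eqVneq (ordS i) j.
  rewrite -Sij (negPf kSi) orient_linear2 ?subrK//; ring.
have [kj|kj] := eqVneq k j; last by ring.
by rewrite -kj orient_linear ?subrK//; ring.
Qed.

(* Cutting off the ear at [j] leaves a part of the polygon that does not depend
   on the position of the vertex [j]. *)
Lemma area_move_vertex m (q : 'I_m -> plane R) (j : 'I_m) (x : plane R) :
  convex_ngon q -> convex_ngon (move_vertex q j x) ->
  orient (q (ord_pred j)) x (q (ordS j)) <=
    orient (q (ord_pred j)) (q j) (q (ordS j)) ->
  (mu (region (move_vertex q j x)) <= mu (region q))%E.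
Proof.
move=> cq cq' le_ear.
have m3 := cq.1; have m2 := leq_trans (isT : (2 <= 3)%N) m3.
have Sj := ordS_neq j m2; have pj := ord_pred_neq j m2.
pose a := q (ord_pred j); pose c := q (ordS j).
have q'j : move_vertex q j x j = x by rewrite /move_vertex eqxx.
have q'k k : k != j -> move_vertex q j x k = q k by rewrite /move_vertex => /negPf ->.
have D0 : 0 < orient a (q j) c by exact: convex_ear_gt0.
have D1 : 0 < orient a x c.
  by have := convex_ear_gt0 j cq'; rewrite q'j !q'k.
pose W : set P2 := region q `&` halfplane a c.
have mW : measurable W.
  by apply: measurableI; [exact: measurable_region|exact: measurable_halfplane].
have dW : W `&` (ear a (q j) c : set P2) = set0.
  rewrite -subset0 => z [[_ z1] [_ [_ z2]]].
  by move: z2 z1; rewrite /open_halfplane /halfplane /= orient_swap oppr_gt0 leNgt => ->.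
have mE y := measurable_ear a y c.
have cov : region (move_vertex q j x) `<=` W `|` ear a x c.
  move=> z rz.
  have e1 : 0 <= orient a x z.
    by have := region_halfplane (ord_pred j) cq' rz; rewrite ord_predK q'j q'k.
  have e2 : 0 <= orient x c z.
    by have := region_halfplane j cq' rz; rewrite q'j q'k.
  have [ca|ca] := ltP 0 (orient c a z); first by right; split.
  have ac : 0 <= orient a c z by rewrite orient_swap oppr_ge0.
  left; split; last exact: ac.
  move: (rz); rewrite region_convex_ngon// => hz.
  (* Fanning from [ordS j] confines the moved vertex to the triangle with [ordS k = j]; every other
     triangle has only vertices common to both polygons. *)
  have [k [kc Skc z1 z2 z3]] := fan (ordS j) m3 hz.
  have kj : k != j by apply: contra Skc => /eqP ->.
  have [Skj|Skj] := eqVneq (ordS k) j.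
    have kE : k = ord_pred j by rewrite -Skj ordSK.
    move: z1 z2 z3; rewrite Skj q'j kE !q'k// -/a -/c => z1 _ _.
    (* In that triangle [z] is on the chord [ac] itself, where the inequalities for [x] and for
       [q j] are proportional. *)
    have ca0 : orient c a z = 0 by apply/eqP; rewrite eq_le ca.
    have ac0 : orient a c z = 0 by rewrite orient_swap ca0 oppr0.
    have Pa : orient a (q j) z * orient a x c = orient a x z * orient a (q j) c.
      by apply/eqP; rewrite -subr_eq0 orient_pluecker orient_swap23 ac0 oppr0 mul0r.
    have Pc : orient (q j) c z * orient a x c = orient x c z * orient a (q j) c.
      have := orient_pluecker c a (q j) x z.
      rewrite (orient_swap (q j) c z) (orient_swap x c z) !(orient_rot a c) ac0 mul0r.
      by rewrite (orient_swap23 a x c) (orient_swap23 a (q j) c) !mulrNN => /eqP; rewrite subr_eq0 => /eqP.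
    apply: (convex_triangle (convex_region q) (region_vertex q (ord_pred j))
      (region_vertex q j) (region_vertex q (ordS j))) => //.
      by rewrite -(pmulr_lge0 _ D1) Pa mulr_ge0// ltW.
    by rewrite -(pmulr_lge0 _ D1) Pc mulr_ge0// ltW.
  move: z1 z2 z3; rewrite !q'k// => z1 z2 z3.
  apply: (convex_triangle (convex_region q) (region_vertex q (ordS j))
      (region_vertex q k) (region_vertex q (ordS k))) => //.
  by rewrite -(orient_rot (q (ordS j))); apply: cq.2; rewrite // eq_sym.
apply: (@le_trans _ _ (mu W + mu (ear a x c))%E).
  apply: le_trans (measureU2 mu mW (mE x)).
  by apply: le_measure; rewrite ?inE//; [exact: measurable_region|exact: measurableU].
apply: (@le_trans _ _ (mu W + mu (ear a (q j) c))%E).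
  apply: leeD2l; rewrite (area_ear (ltW D1)) (area_ear (ltW D0)) lee_fin.
  by rewrite ler_pM2r.
rewrite -[leLHS]measureU//; apply: le_measure; rewrite ?inE//.
- exact: measurableU.
- exact: measurable_region.
- rewrite subUset; split; first by move=> z [].
  by apply: ear_sub; [exact: convex_region|exact: region_vertex..].
Qed.

Lemma parallel_trans (d1 d2 X1 X2 Y1 Y2 : R) : (d1 != 0) || (d2 != 0) ->
  X1 * d2 - X2 * d1 = 0 -> Y1 * d2 - Y2 * d1 = 0 -> X1 * Y2 - X2 * Y1 = 0.
Proof.
move=> /orP[d0|d0] E1 E2; apply: (mulfI d0); rewrite mulr0.
  have -> : d1 * (X1 * Y2 - X2 * Y1) =
    Y1 * (X1 * d2 - X2 * d1) - X1 * (Y1 * d2 - Y2 * d1) by ring.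
  by rewrite E1 E2 !mulr0 subr0.
have -> : d2 * (X1 * Y2 - X2 * Y1) =
  Y2 * (X1 * d2 - X2 * d1) - X2 * (Y1 * d2 - Y2 * d1) by ring.
by rewrite E1 E2 !mulr0 subr0.
Qed.

(** If the regions agreed, [q j] and [x] would each satisfy the edge inequalities of the other
    polygon. These have opposite signs, so the direction of motion would be parallel to both edges
    at [q j], against the positive ear there. *)
Lemma move_vertex_region_neq m (q : 'I_m -> plane R) (j : 'I_m) (y : plane R) t :
  convex_ngon q -> y != q j -> t != 0 ->
  convex_ngon (move_vertex q j ((1 - t) *: q j + t *: y)) ->
  region (move_vertex q j ((1 - t) *: q j + t *: y)) <> region q.
Proof.
move=> cq yq t0; set x := (1 - t) *: _ + _ => cq' E.
have m2 := leq_trans (isT : (2 <= 3)%N) cq.1.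
have Sj := ordS_neq j m2; have pj := ord_pred_neq j m2.
have q'j : move_vertex q j x j = x by rewrite /move_vertex eqxx.
have q'k k : k != j -> move_vertex q j x k = q k by rewrite /move_vertex => /negPf ->.
have rx : region q x by rewrite -E -{2}q'j; exact: region_vertex.
have rq : region (move_vertex q j x) (q j) by rewrite E; exact: region_vertex.
have h1 := region_halfplane (ord_pred j) cq rx; have h2 := region_halfplane j cq rx.
have h3 := region_halfplane (ord_pred j) cq' rq; have h4 := region_halfplane j cq' rq.
rewrite ord_predK in h1; rewrite ord_predK q'j q'k// in h3; rewrite q'j q'k// in h4.
have D0 := convex_ear_gt0 j cq.
have h5 : t * orient (q (ord_pred j)) (q j) y = 0.
  move: h1 h3; rewrite (orient_swap23 _ (q j) x) /x orient_linear ?subrK// orientxyy mulr0 add0r.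
  by move=> *; lra.
have h6 : t * orient (q j) (q (ordS j)) y = 0.
  move: h2 h4; rewrite (orient_rot (q j) x) (orient_swap23 _ (q (ordS j)) x).
  rewrite /x orient_linear ?subrK// orientxyx mulr0 add0r.
  by move=> *; lra.
move: h5 h6 D0 => /eqP; rewrite mulf_eq0 (negPf t0) /= => /eqP.
move=> + /eqP; rewrite mulf_eq0 (negPf t0) /= => + /eqP.
move: yq {h1 h2 h3 h4 rx rq cq' E q'j q'k x}; move: (q j) (q (ord_pred j)) (q (ordS j)) y.
move=> [x1 x2] [a1 a2] [c1 c2] [y1 y2]; rewrite !orientE => yx h5 h6.
suff : (x1 - a1) * (c2 - x2) - (x2 - a2) * (c1 - x1) = 0 by move=> *; lra.
apply: (@parallel_trans (y1 - x1) (y2 - x2)).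
- by move: yx; rewrite xpair_eqE negb_and !subr_eq0.
- by lra.
- by lra.
Qed.

(* The side between two unused vertices has a vertex of [q] in its interior,
   which can slide along the side in either direction; the area is affine in the
   displacement. *)
Lemma min_area_two_unused n m (p : 'I_n -> plane R) (q : 'I_m -> plane R) (i : 'I_n) :
  convex_ngon p -> unique_min_area_inscribed p q ->
  ~ range q (p i) -> ~ range q (p (ordS i)) -> False.
Proof.
move=> cp [minq uniq] ni nSi.
have [[cq sq] _] := minq.
have [j [t]] := sq i; rewrite /= in_itv /= => /andP[t0 t1] qj.
have {}t0 : 0 < t.
  rewrite lt_neqAle t0 andbT; apply/eqP => t0'; apply: ni; exists j => //.
  by rewrite -qj -t0' subr0 scale1r scale0r addr0.
have {}t1 : t < 1.
  rewrite lt_neqAle t1 andbT; apply/eqP => t1'; apply: nSi; exists j => //.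
  by rewrite -qj t1' subrr scale1r scale0r add0r.
pose y := q j + (p (ordS i) - p i).
have yq : y != q j.
  rewrite /y -subr_eq0 addrAC subrr add0r subr_eq0; apply/eqP => /(convex_ngon_inj cp)/eqP.
  by apply/negP/ordS_neq; apply: leq_trans cp.1.
have [d /andP[d0 d1] dP] := move_vertex_convex j y cq.
pose g := orient (q (ord_pred j)) y (q (ordS j)) -
          orient (q (ord_pred j)) (q j) (q (ordS j)).
(* Small enough for three purposes: [e <= d] preserves convexity, while [e <= t] and [e <= 1 - t]
   keep the vertex on its side. *)
pose e := d * (t * (1 - t)).
have tt0 : 0 < t * (1 - t) by rewrite mulr_gt0// subr_gt0.
have e0 : 0 < e by rewrite mulr_gt0.
have ed : e <= d by rewrite /e ger_pMr//; nra.
have et : e <= t by rewrite /e; nra.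
have et1 : e <= 1 - t by rewrite /e; nra.
have [s [s0 sd st sg]] : exists s, [/\ s != 0, `|s| <= d, 0 <= t + s <= 1 & s * g <= 0].
  have [g0|/ltW g0] := leP 0 g.
    exists (- e); rewrite oppr_eq0 gt_eqF// normrN gtr0_norm//; split => //; nra.
  by exists e; rewrite gt_eqF// gtr0_norm//; split => //; nra.
set x := (1 - s) *: q j + s *: y.
have xE : x = (1 - (t + s)) *: p i + (t + s) *: p (ordS i).
  rewrite /x /y -qj; move: (p i) (p (ordS i)) => [a1 a2] [b1 b2].
  rewrite [LHS](_ : _ = ((1 - s) * ((1 - t) * a1 + t * b1) + s * ((1 - t) * a1 + t * b1 + (b1 - a1)),
    (1 - s) * ((1 - t) * a2 + t * b2) + s * ((1 - t) * a2 + t * b2 + (b2 - a2))))//.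
  rewrite [RHS](_ : _ = ((1 - (t + s)) * a1 + (t + s) * b1, (1 - (t + s)) * a2 + (t + s) * b2))//.
  by congr pair; ring.
have cq' := dP s sd; rewrite -/x in cq'.
have le_ear : orient (q (ord_pred j)) x (q (ordS j)) <=
    orient (q (ord_pred j)) (q j) (q (ordS j)).
  by rewrite /x orient_linear2 ?subrK//; move: sg; rewrite /g; nra.
have inq : inscribed p (move_vertex q j x).
  split => // k; have [ki|ki] := eqVneq k i.
    by exists j; rewrite ki /move_vertex eqxx xE; exists (t + s); rewrite //= in_itv.
  have [l sl] := sq k; exists l; rewrite /move_vertex; case: eqP => // lj.
  move: sl ki; rewrite lj -qj => /(side_relint cp) -> //; first by rewrite eqxx.
  by rewrite t0 t1.
have minq' : min_area_inscribed p (move_vertex q j x).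
  split => //; rewrite -minq.2; apply/eqP; rewrite eq_le.
  by rewrite [X in _ && X](min_area_le minq inq) area_move_vertex.
exact: (move_vertex_region_neq cq yq s0 cq' (uniq _ _ minq')).
Qed.

Lemma necessity n m (p : 'I_n -> plane R) (q : 'I_m -> plane R) :
  (5 <= n)%N -> convex_ngon p -> unique_min_area_inscribed p q ->
  no_two_consecutive_unused (used_seq p q) /\ no_three_consecutive_used (used_seq p q).
Proof.
move=> n5 cp uq; split.
  move=> [i []]; rewrite !ffunE; case: ifPn => // ni _; case: ifPn => // nSi _.
  apply: (min_area_two_unused cp uq (i := i)).
    by move: ni; rewrite notin_setE.
  by move: nSi; rewrite notin_setE.
move=> [i []]; rewrite !ffunE; case: ifPn => // n0 _; case: ifPn => // n1 _.
case: ifPn => // n2 _; move: n0 n1 n2; rewrite !inE.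
exact: min_area_three_vertices uq.1.
Qed.

End Perturbation.

(** * A sufficient condition on the ears *)

Section Criterion.
Variable R : realType.
Local Notation mu := (area_measure R).
Local Notation P2 := (measurableTypeR R * measurableTypeR R)%type.

(* Each used vertex is charged to an unused neighbor [l]: its coefficient in the
   sum is at most [1 - y l]. *)
Lemma cyclic_weights n (u : pred 'I_n) (w y : 'I_n -> R) :
  (forall k, 0 <= w k) -> (forall k, 0 <= y k) ->
  (forall k, y k + y (ordS k) <= 1) ->
  (forall k, u k -> ~~ u (ord_pred k) || ~~ u (ordS k)) ->
  (forall k, ~~ u k -> w (ord_pred k) + w (ordS k) < w k) ->
  \sum_k y k * w k <= \sum_(k | ~~ u k) w k /\
  (\sum_(k | ~~ u k) w k <= \sum_k y k * w k -> forall k, ~~ u k -> y k = 1).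
Proof.
move=> w0 y0 y1 uu big.
have y1' k : y k <= 1 by have := y1 k; have := y0 (ordS k); lra.
pose gap k := (1 - y k) * (w k - (w (ord_pred k) + w (ordS k))).
have gap0 k : ~~ u k -> 0 <= gap k.
  by move=> uk; apply: mulr_ge0; rewrite subr_ge0 ?y1'// ltW// big.
have key : \sum_k y k * w k + \sum_(k | ~~ u k) gap k <= \sum_(k | ~~ u k) w k.
  pose f k := if u (ordS k) then 0 else (1 - y (ordS k)) * w k.
  pose g k := if u (ord_pred k) then 0 else (1 - y (ord_pred k)) * w k.
  have f0 k : 0 <= f k by rewrite /f; case: ifP => // _; rewrite mulr_ge0// subr_ge0.
  have g0 k : 0 <= g k by rewrite /g; case: ifP => // _; rewrite mulr_ge0// subr_ge0.
  have usedle k : u k -> y k * w k <= f k + g k.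
    move=> /uu /orP[|] un.
      apply: (@le_trans _ _ (g k)); last by rewrite lerDr.
      rewrite /g (negPf un) ler_wpM2r//.
      by have := y1 (ord_pred k); rewrite ord_predK; lra.
    apply: (@le_trans _ _ (f k)); last by rewrite lerDl.
    rewrite /f (negPf un) ler_wpM2r//; by have := y1 k; lra.
  have fE : \sum_k f k = \sum_(k | ~~ u k) (1 - y k) * w (ord_pred k).
    rewrite [RHS]big_mkcond [RHS](reindex_inj (@ordS_inj n)) /=.
    by apply: eq_bigr => k _; rewrite /f ordSK; case: (u _).
  have gE : \sum_k g k = \sum_(k | ~~ u k) (1 - y k) * w (ordS k).
    rewrite [RHS]big_mkcond [LHS](reindex_inj (@ordS_inj n)) /=.
    by apply: eq_bigr => k _; rewrite /g ordSK; case: (u _).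
  rewrite (bigID u)/=.
  apply: (@le_trans _ _ ((\sum_k f k + \sum_k g k) + \sum_(k | ~~ u k) y k * w k +
    \sum_(k | ~~ u k) gap k)).
    rewrite !lerD2r -big_split /= [leRHS](bigID u) /=.
    apply: ler_wpDr; first by apply: sumr_ge0 => k _; rewrite addr_ge0.
    exact: ler_sum.
  rewrite fE gE -!big_split /=; apply: ler_sum => k _.
  by rewrite /gap; lra.
split.
  apply: le_trans key; rewrite lerDl; exact: sumr_ge0.
move=> le k uk.
have sum0 : \sum_(k | ~~ u k) gap k <= 0 by move: key le; lra.
have : gap k <= 0.
  apply: le_trans sum0; rewrite (bigD1 k)//= lerDl.
  by apply: sumr_ge0 => l /andP[ul _]; exact: gap0.
rewrite /gap pmulr_lle0 ?subr_gt0 ?big//.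
by have := y1' k; lra.
Qed.

Lemma measure_bigsetU_le (I : Type) (s : seq I) (P : pred I) (F : I -> set P2) :
  (forall i, measurable (F i)) ->
  (mu (\big[setU/set0]_(i <- s | P i) F i) <= \sum_(i <- s | P i) mu (F i))%E.
Proof.
move=> mF; elim: s => [|i s IH]; first by rewrite !big_nil measure0.
rewrite !big_cons; case: ifP => // _.
apply: le_trans (measureU2 _ _ _) _ => //; first exact: bigsetU_measurable.
exact: leeD2l.
Qed.

Section CutCorners.
Variables (n : nat) (p : 'I_n -> plane R) (t : 'I_n -> R).
Hypothesis cp : convex_ngon p.
Hypothesis t01 : forall i, 0 <= t i <= 1.

Let x i := (1 - t i) *: p i + t i *: p (ordS i).
Let w k := orient (p (ord_pred k)) (p k) (p (ordS k)).
Let y k := (1 - t (ord_pred k)) * t k.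

Lemma orient_corner k z : orient (x (ord_pred k)) (p k) z =
  (1 - t (ord_pred k)) * orient (p (ord_pred k)) (p k) z.
Proof. by rewrite /x ord_predK orient_linear1 ?subrK// orientxx mulr0 addr0. Qed.

Lemma orient_corner' k z : orient (p k) (x k) z = t k * orient (p k) (p (ordS k)) z.
Proof. by rewrite /x orient_linear2 ?subrK// orientxx mulr0 add0r. Qed.

Lemma orient_corner_ear k : orient (x (ord_pred k)) (p k) (x k) = y k * w k.
Proof.
rewrite orient_corner /y -mulrA; congr (_ * _).
by rewrite -orient_rot orient_corner' orient_rot.
Qed.

(* An edge of [q] that separates a point [z] of [p] from [q] also cuts off some
   vertex of [p], and the ear at any such vertex contains [z]. *)
Lemma area_cut_corners m (q : 'I_m -> plane R) : convex_ngon q ->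
  (forall i, exists j, q j = x i) ->
  (mu (region p) <= mu (region q) + ((\sum_k y k * w k) / 2)%:E)%E.
Proof.
move=> cq qx.
pose T k : set P2 := ear (x (ord_pred k)) (p k) (x k).
have mT k : measurable (T k) by exact: measurable_ear.
have cov : region p `<=` region q `|` \big[setU/set0]_k T k.
  move=> z rz; have [rqz|nqz] := pselect (region q z); first by left.
  right; rewrite -bigcup_seq.
  have [e Lz] : exists e, orient (q e) (q (ordS e)) z < 0.
    apply: contrapT => /forallNP H; apply: nqz; rewrite region_convex_ngon// => e.
    by rewrite leNgt; apply/negP; exact: H.
  pose L := orient (q e) (q (ordS e)); rewrite -/(L z) in Lz.
  have Lx i : 0 <= L (x i).
    by have [j <-] := qx i; apply: region_halfplane => //; exact: region_vertex.
  have [k Lk] : exists k, L (p k) < 0.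
    apply: contrapT => /forallNP H; move: Lz; apply/negP; rewrite -leNgt.
    apply: (region_sub (convex_halfplane (q e) (q (ordS e))) _ rz) => k.
    by rewrite /halfplane /= leNgt; apply/negP; exact: H.
  exists k; first by rewrite /= mem_index_enum.
  (* Otherwise [p k] would be the point [x k], a vertex of [q], where [L] is nonnegative. *)
  have tk : 0 < t k.
    have /andP[tk0 _] := t01 k; rewrite lt_neqAle tk0 andbT; apply/eqP => tk.
    by have := Lx k; rewrite /x -tk subr0 scale1r scale0r addr0 leNgt Lk.
  have tpk : 0 < 1 - t (ord_pred k).
    have /andP[_ tk1] := t01 (ord_pred k).
    rewrite subr_gt0 lt_neqAle tk1 andbT; apply/eqP => tk1'.
    by have := Lx (ord_pred k); rewrite /x ord_predK tk1' subrr scale1r scale0r add0r leNgt Lk.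
  have e1 : 0 <= orient (x (ord_pred k)) (p k) z.
    rewrite orient_corner mulr_ge0 ?(ltW tpk)//.
    by have := region_halfplane (ord_pred k) cp rz; rewrite ord_predK.
  have e2 : 0 <= orient (p k) (x k) z.
    by rewrite orient_corner' mulr_ge0 ?(ltW tk)//; exact: region_halfplane.
  have D0 : 0 < orient (x (ord_pred k)) (p k) (x k).
    by rewrite orient_corner_ear mulr_gt0 ?mulr_gt0//; exact: convex_ear_gt0.
  split => //; split => //; rewrite /open_halfplane /=.
  (* [L] is affine, so [L z] is a barycentric combination of its values at the corner. Only
     [L (p k)] is negative; were [z] not beyond the chord, its coefficient would be nonpositive and
     [L z] nonnegative. *)
  have E : orient (x (ord_pred k)) (p k) (x k) * L z =
      orient (p k) (x k) z * L (x (ord_pred k)) + orient (x k) (x (ord_pred k)) z * L (p k) +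
      orient (x (ord_pred k)) (p k) z * L (x k).
    rewrite /L; move: (x (ord_pred k)) (p k) (x k) (q e) (q (ordS e)) (z).
    by move=> [? ?] [? ?] [? ?] [? ?] [? ?] [? ?]; rewrite !orientE; ring.
  have := Lx k; have := Lx (ord_pred k) => l1 l2.
  rewrite ltNge; apply/negP => o0.
  have : orient (x (ord_pred k)) (p k) (x k) * L z < 0 by rewrite pmulr_rlt0.
  rewrite E ltNge => /negP; apply; apply: addr_ge0; last exact: mulr_ge0.
  by apply: addr_ge0; [exact: mulr_ge0|apply: mulr_le0 => //; exact: ltW].
apply: (@le_trans _ _ (mu (region q `|` \big[setU/set0]_k T k))).
  apply: le_measure; rewrite ?inE//; first exact: measurable_region.
  by apply: measurableU; [exact: measurable_region|exact: bigsetU_measurable].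
apply: le_trans (measureU2 _ _ _) _; first exact: measurable_region.
  exact: bigsetU_measurable.
apply: leeD2l; apply: le_trans (measure_bigsetU_le _ _ mT) _.
rewrite mulr_suml -sumEFin le_eqVlt; apply/orP; left; apply/eqP; apply: eq_bigr => k _.
have /andP[_ t1] := t01 (ord_pred k); have /andP[t0 _] := t01 k.
rewrite area_ear orient_corner_ear// mulr_ge0//; last exact/ltW/convex_ear_gt0.
by rewrite mulr_ge0// subr_ge0.
Qed.

End CutCorners.

Lemma area_disjoint_ears n m (p : 'I_n -> plane R) (q : 'I_m -> plane R) (u : pred 'I_n) :
  convex_ngon p -> convex_ngon q ->
  (forall j, exists2 k, u k & q j = p k) ->
  (forall k, u k || u (ordS k)) ->
  (mu (region q) + ((\sum_(k | ~~ u k)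
     orient (p (ord_pred k)) (p k) (p (ordS k))) / 2)%:E <= mu (region p))%E.
Proof.
move=> cp cq qp uu.
pose E k : set P2 := ear (p (ord_pred k)) (p k) (p (ordS k)).
have n2 : (2 <= n)%N by apply: leq_trans cp.1.
have mE k : measurable (E k) by exact: measurable_ear.
have chordE k (A : set P2) : A `<=` halfplane (p (ord_pred k)) (p (ordS k)) ->
    A `&` E k = set0.
  move=> Ah; rewrite -subset0 => z [/Ah + [_ [_]]].
  by rewrite /halfplane /open_halfplane /= (orient_swap (p (ord_pred k))) oppr_gt0 leNgt => /negP.
have tE : trivIset [set` [pred k | ~~ u k]] E.
  apply/trivIsetP => k l /= uk ul kl; rewrite setIC; apply: chordE.
  apply: ear_sub; first exact: convex_halfplane.
  - apply: convex_chord => //; apply: contra uk => /eqP <-.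
    by have := uu (ord_pred l); rewrite ord_predK (negPf ul) orbF.
  - by apply: convex_chord => //; rewrite eq_sym.
  - apply: convex_chord => //; apply: contra uk => /eqP <-.
    by have := uu l; rewrite (negPf ul).
have -> : ((\sum_(k | ~~ u k) orient (p (ord_pred k)) (p k) (p (ordS k))) / 2)%:E =
    mu (\big[setU/set0]_(k < n | ~~ u k) E k).
  rewrite (@measure_bigsetU_ord_cond _ _ _ mu n [pred k | ~~ u k])//.
  rewrite mulr_suml -sumEFin; apply: eq_bigr => k _.
  exact: esym (area_ear (ltW (convex_ear_gt0 k cp))).
have dq : region q `&` \big[setU/set0]_(k < n | ~~ u k) E k = set0.
  rewrite -subset0 => z [rz]; rewrite -bigcup_seq_cond => -[k /= /andP[_ uk] Ek].
  have : (region q `&` E k) z by split.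
  rewrite chordE//.
  apply: region_sub; first exact: convex_halfplane.
  move=> j; have [l ul ->] := qp j; apply: convex_chord => //.
  by apply: contraNneq uk => <-.
rewrite -[leLHS]measureU//; [|exact: measurable_region|exact: bigsetU_measurable].
apply: le_measure; rewrite ?inE.
- by apply: measurableU; [exact: measurable_region|exact: bigsetU_measurable].
- exact: measurable_region.
- rewrite subUset; split.
    apply: region_sub; first exact: convex_region.
    by move=> j; have [l _ ->] := qp j; exact: region_vertex.
  rewrite -bigcup_seq_cond => z [k _].
  by apply: ear_sub; [exact: convex_region|exact: region_vertex..].
Qed.


Lemma ear_criterion n m (p : 'I_n -> plane R) (q : 'I_m -> plane R) (u : pred 'I_n) :
  convex_ngon p -> convex_ngon q ->
  (forall j, exists2 k, u k & q j = p k) ->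
  (forall k, u k -> range q (p k)) ->
  (forall k, u k || u (ordS k)) ->
  (forall k, u k -> ~~ u (ord_pred k) || ~~ u (ordS k)) ->
  (forall k, ~~ u k ->
    orient (p (ord_pred (ord_pred k))) (p (ord_pred k)) (p (ordS (ord_pred k))) +
    orient (p (ord_pred (ordS k))) (p (ordS k)) (p (ordS (ordS k))) <
    orient (p (ord_pred k)) (p k) (p (ordS k))) ->
  unique_min_area_inscribed p q.
Proof.
move=> cp cq qp pq uS uu big.
pose w k := orient (p (ord_pred k)) (p k) (p (ordS k)).
have w0 k : 0 < w k by exact: convex_ear_gt0.
have lower := area_disjoint_ears cp cq qp uS.
have inq : inscribed p q.
  split => // i; case/orP: (uS i) => ui; have [j _ qj] := pq _ ui; exists j; rewrite qj.
    exact: side_start.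
  exact: side_end.
have main m' (q' : 'I_m' -> plane R) : inscribed p q' ->
    (mu (region q) <= mu (region q'))%E /\
    ((mu (region q') <= mu (region q))%E -> region q' = region q).
  move=> [cq' sq'].
  have [t tP] : {t : 'I_n -> R & forall i, 0 <= t i <= 1 /\
      exists j, q' j = (1 - t i) *: p i + t i *: p (ordS i)}.
    apply: (@choice _ _ (fun i t => 0 <= t <= 1 /\
      exists j, q' j = (1 - t) *: p i + t *: p (ordS i))) => i.
    have [j [t]] := sq' i; rewrite /= in_itv /= => t01 E.
    by exists t; split => //; exists j.
  have t01 i : 0 <= t i <= 1 := (tP i).1.
  have tx i := (tP i).2.
  have upper := area_cut_corners cp t01 cq' tx.
  pose y k := (1 - t (ord_pred k)) * t k.
  have y0 k : 0 <= y k.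
    have /andP[_ t1] := t01 (ord_pred k); have /andP[t0 _] := t01 k.
    by rewrite mulr_ge0// subr_ge0.
  (* The two terms are at most [t k] and [1 - t k]. *)
  have y1 k : y k + y (ordS k) <= 1.
    have /andP[a0 a1] := t01 (ord_pred k); have /andP[b0 b1] := t01 k.
    by have /andP[c0 c1] := t01 (ordS k); rewrite /y ordSK; nra.
  have [le eq] := cyclic_weights (fun k => ltW (w0 k)) y0 y1 uu big.
  have := le_trans lower upper; rewrite -/w.
  rewrite -(fineK (area_region_fin cq)) -(fineK (area_region_fin cq')) -!EFinD !lee_fin.
  rewrite -/(w _) => both.
  split; first by move: both le; rewrite /w /y; lra.
  move=> le'; have y_eq1 := eq _.
  have {}y_eq1 k : ~~ u k -> y k = 1.
    by apply: y_eq1; move: both le'; rewrite /w /y; lra.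
  apply/esym/region_eq_of_area => //; last first.
    rewrite -(fineK (area_region_fin cq)) -(fineK (area_region_fin cq')) lee_fin.
    exact: le'.
  apply: region_sub; first exact: convex_region.
  move=> j; have [k uk ->] := qp j.
  have tl l : ~~ u l -> t (ord_pred l) = 0 /\ t l = 1.
    move=> /y_eq1; rewrite /y.
    have /andP[a0 a1] := t01 (ord_pred l); have /andP[b0 b1] := t01 l.
    by move=> E; split; nra.
  case/orP: (uu k uk) => un.
    have [_ t1] := tl _ un; have [l ql] := tx (ord_pred k).
    have -> : p k = q' l by rewrite ql t1 ord_predK subrr scale0r scale1r add0r.
    exact: region_vertex.
  have [t0 _] := tl _ un; have [l ql] := tx k.
  have -> : p k = q' l by rewrite ql; rewrite ordSK in t0; rewrite t0 subr0 scale0r scale1r addr0.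
  exact: region_vertex.
have infE : mu (region q) = ereal_inf (inscribed_areas p).
  apply/eqP; rewrite eq_le; apply/andP; split.
    by apply: le_ereal_inf_tmp => _ [m' [q' [iq' ->]]]; exact: (main _ _ iq').1.
  by apply: ereal_inf_lbound; exists m, q.
split; first by [].
move=> m' q' [iq' E]; apply: (main _ _ iq').2.
by rewrite infE -E.
Qed.

End Criterion.

(** * Construction of the circumscribed polygon *)

Section UsedVertices.

Lemma enum_val_ltn n (A : {pred 'I_n}) (i j : 'I_#|A|) : (i < j)%N ->
  (enum_val i < enum_val j)%N.
Proof.
move=> ij; have x0 : 'I_n by exact: enum_val i.
rewrite !(enum_val_nth x0).
have srt : sorted (relpre (val : 'I_n -> nat) ltn) (enum A).
  rewrite /enum_mem sorted_filter//; first by move=> a b c /=; exact: ltn_trans.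
  by rewrite -sorted_map -enumT val_enum_ord; exact: iota_ltn_sorted.
have tr : transitive (relpre (val : 'I_n -> nat) ltn) by move=> a b c /=; exact: ltn_trans.
by apply: (sorted_ltn_nth tr x0 srt) => //; rewrite inE -cardE ltn_ord.
Qed.

(** If [i] is used, the pairs at distances 1, 2 and 3, 4 after it supply two more used vertices. If
    not, both its neighbors are used, and the pair at distances 2, 3 supplies the third. All these
    positions are distinct as [n >= 5]. *)
Lemma card_used_ge3 n (u : pred 'I_n) : (5 <= n)%N ->
  (forall k, u k || u (ordS k)) -> (3 <= #|u|)%N.
Proof.
move=> n5 uS.
have i : 'I_n by exists 0%N; exact: leq_trans n5.
have ne r r' : (r < r' < n)%N -> iter r (@ordS n) i != iter r' (@ordS n) i.
  move=> /andP[rr rn].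
  have : iter (r' - r) (@ordS n) (iter r (@ordS n) i) != iter r (@ordS n) i.
    by apply: iter_ordS_neq; lia.
  by rewrite -iterD subnK 1?eq_sym// ltnW.
have card3 (r1 r2 r3 : nat) : (r1 < r2 < r3)%N -> (r3 < n)%N ->
    u (iter r1 (@ordS n) i) -> u (iter r2 (@ordS n) i) -> u (iter r3 (@ordS n) i) ->
    (3 <= #|u|)%N.
  move=> r12 r3n u1 u2 u3.
  set a := iter r1 _ _ in u1; set b := iter r2 _ _ in u2; set c := iter r3 _ _ in u3.
  have un : uniq [:: a; b; c].
    by rewrite /= !inE !negb_or !ne//; lia.
  have := card_uniqP un => /= <-; apply: subset_leq_card; apply/fintype.subsetP => x.
  by rewrite !inE => /or3P[] /eqP ->.
have u12 := uS (iter 1 (@ordS n) i); have u23 := uS (iter 2 (@ordS n) i).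
have u34 := uS (iter 3 (@ordS n) i); rewrite -!iterS in u12 u23 u34.
have [u0|u0] := boolP (u i).
  by case/orP: u12 => u12; case/orP: u34 => u34;
    apply: (card3 0%N _ _ _ _ u0 u12 u34); lia.
have u1 : u (iter 1 (@ordS n) i) by have := uS i; rewrite (negPf u0).
have un : u (iter n.-1 (@ordS n) i).
  have := uS (iter n.-1 (@ordS n) i); rewrite -iterS prednK; last by lia.
  by rewrite iter_ordS_id (negPf u0) orbF.
by case/orP: u23 => u23; apply: (card3 _ _ _ _ _ u1 u23 un); lia.
Qed.

End UsedVertices.

(** * Cyclic order of indices displaced by at most one step *)

Definition near_mod (n a b : nat) :=
  [\/ b = a, b.+1 = a, b = a.+1 | (a = 0%N /\ b.+1 = n) \/ (a.+1 = n /\ b = 0%N)].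

(** Apart from wrapping around at 0 or [n - 1], the order could break only if adjacent indices
    exchanged places, which the two implications exclude. *)
Lemma near_mod_le n i j x y : (i < j < n)%N -> (x = j -> y = j) -> (y = i -> x = i) ->
  near_mod n i x -> near_mod n j y ->
  [\/ (x <= y)%N, i = 0%N /\ x.+1 = n | j.+1 = n /\ y = 0%N].
Proof.
move=> /andP[ij jn] h1 h2 X Y.
have [xy|yx] := leqP x y; first by constructor 1.
case: Y => [yj|yj|yj|[[j0 _]|yn]]; last by constructor 3.
- case: X => [xi|xi|xi|[x0|[xn _]]]; last 2 first; first by constructor 2.
  + by lia.
  + by lia.
  + by lia.
  + by lia.
- case: X => [xi|xi|xi|[x0|[xn _]]]; last 2 first; first by constructor 2.
  + by lia.
  + by lia.
  + by lia.
  + by have [xj|xj] := eqVneq x j; [have := h1 xj|have := h2]; lia.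
- case: X => [xi|xi|xi|[x0|[xn _]]]; last 2 first; first by constructor 2.
  + by lia.
  + by lia.
  + by lia.
  + by lia.
- by lia.
Qed.

(** Only [x] can wrap downwards and only [z] upwards. Either event merely rotates the cyclic order,
    and both together would exchange [i] and [k]. *)
Lemma cyclic_order_near n i j k x y z : (5 <= n)%N -> (i < j < k)%N ->
  (x = j -> y = j) -> (x = k -> z = k) -> (y = i -> x = i) ->
  (y = k -> z = k) -> (z = i -> x = i) -> (z = j -> y = j) ->
  (x < n)%N -> (y < n)%N -> (z < n)%N -> (k < n)%N ->
  near_mod n i x -> near_mod n j y -> near_mod n k z ->
  [|| (x <= y <= z)%N, (y <= z <= x)%N | (z <= x <= y)%N].
Proof.
move=> n5 /andP[ij jk] h1 h2 h3 h4 h5 h6 nx ny nz nk X Y Z.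
have jn := ltn_trans jk nk.
have xy := near_mod_le (introT andP (conj ij jn)) h1 h3 X Y.
have yz := near_mod_le (introT andP (conj jk nk)) h4 h6 Y Z.
have [[i0 xn]|nX] := pselect (i = 0%N /\ x.+1 = n).
  have yzle : (y <= z)%N.
    case: yz => // [[j0 _]|[kn z0]]; first by lia.
    have xk : x = k by apply: succn_inj; rewrite xn kn.
    by move: kn n5; rewrite -(h2 xk) z0 => <-.
  by apply/or3P; constructor 2; rewrite yzle; lia.
have xyle : (x <= y)%N by case: xy => // [[jn' _]]; lia.
case: yz => [yzle|[j0 _]|[_ z0]].
- by rewrite xyle yzle.
- by lia.
- by rewrite z0 xyle !orbT.
Qed.

(** * Perturbed points of a parabola *)

Section Construction.
Variables (R : realType) (n : nat) (u : pred 'I_n).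
Hypothesis n5 : (5 <= n)%N.
Hypothesis uS : forall k, u k || u (ordS k).
Hypothesis uu : forall k, u k -> ~~ u (ord_pred k) || ~~ u (ordS k).

Definition parabola (x : nat) : plane R := (x%:R, x%:R ^+ 2).

(** A Vandermonde determinant: its sign is the cyclic order of the parameters, and being an integer
    it is at least 1 when positive. *)
Lemma orient_parabola x y z : orient (parabola x) (parabola y) (parabola z) =
  (y%:R - x%:R) * (z%:R - x%:R) * (z%:R - y%:R).
Proof. by rewrite orientE; ring. Qed.

Lemma orient_parabola_ge0 x y z :
  [|| (x <= y <= z)%N, (y <= z <= x)%N | (z <= x <= y)%N] ->
  0 <= orient (parabola x) (parabola y) (parabola z).
Proof.
rewrite orient_parabola => /or3P[] /andP[]; rewrite -!(ler_nat R) => h1 h2.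
- by apply: mulr_ge0; [apply: mulr_ge0|]; lra.
- by rewrite mulr_ge0// ?mulr_le0//; lra.
- by rewrite -mulrA mulr_ge0// ?mulr_le0//; lra.
Qed.

Lemma orient_parabola_ge1 x y z :
  [|| (x < y < z)%N, (y < z < x)%N | (z < x < y)%N] ->
  1 <= orient (parabola x) (parabola y) (parabola z).
Proof.
have H (a b c : nat) : (a < b < c)%N -> 1 <= orient (parabola a) (parabola b) (parabola c).
  rewrite orient_parabola => /andP[ab bc].
  rewrite -!natrB ?(ltnW ab) ?(ltnW bc) ?(ltnW (ltn_trans ab bc))// -!natrM ler1n.
  by rewrite !muln_gt0 !subn_gt0 ab bc (ltn_trans ab bc).
move=> /or3P[h|h|h]; first exact: H.
  by rewrite -orient_rot; exact: H.
by rewrite orient_rot; exact: H.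
Qed.

Lemma orient_parabola_le x y z : (x < n)%N -> (y < n)%N -> (z < n)%N ->
  orient (parabola x) (parabola y) (parabola z) <= n%:R ^+ 3.
Proof.
move=> xn yn zn; rewrite orient_parabola; apply: le_trans (ler_norm _) _.
have bd (a b : nat) : (a < n)%N -> (b < n)%N -> `|a%:R - b%:R : R| <= n%:R.
  move=> /ltnW an /ltnW bn; rewrite -(ler_nat R) in an; rewrite -(ler_nat R) in bn.
  have a0 : 0 <= a%:R :> R by []; have b0 : 0 <= b%:R :> R by [].
  by rewrite ler_norml; apply/andP; split; lra.
rewrite !normrM exprS expr2 mulrA; do 2 ?apply: ler_pM; rewrite ?mulr_ge0//; exact: bd.
Qed.

(* An unused vertex and the first of two consecutive used ones lie on the
   parabola; the second of two consecutive used vertices is close to the first,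
   and an isolated used vertex is close to the midpoint of its neighbors. Each
   vertex is the average of the points [supl], [supr] pushed by [eps] towards its
   own point of the parabola. *)
Definition supl k := if u k && (u (ord_pred k) || ~~ u (ordS k)) then ord_pred k else k.

Definition supr k :=
  if u k then if u (ord_pred k) then ord_pred k else if u (ordS k) then k else ordS k
  else k.

Definition eps : R := (8 * (n%:R ^+ 3 + 1))^-1.

Definition pt k : plane R :=
  (1 - eps) *: (2^-1 *: parabola (supl k) + (1 - 2^-1) *: parabola (supr k))
  + eps *: parabola k.

Lemma eps_bounds : [/\ 0 < eps, eps < 1 & eps * n%:R ^+ 3 < 8^-1].
Proof.
have n0 : 0 <= n%:R ^+ 3 :> R by exact: exprn_ge0.
have d0 : 0 < 8 * (n%:R ^+ 3 + 1) :> R by lra.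
split; first by rewrite invr_gt0.
  by rewrite invf_lt1//; lra.
by rewrite /eps mulrC ltr_pdivrMr//; lra.
Qed.

(** Stated for an arbitrary affine [f], so that it serves each argument of [orient] in turn. *)
Lemma orient_pt (f : plane R -> R) k :
  (forall x y s t, s + t = 1 -> f (s *: x + t *: y) = s * f x + t * f y) ->
  f (pt k) = (1 - eps) * (2^-1 * f (parabola (supl k)) + 2^-1 * f (parabola (supr k)))
    + eps * f (parabola k).
Proof.
move=> lf; rewrite /pt lf ?subrK// lf ?subrKC//.
by have -> : 1 - 2^-1 = 2^-1 :> R by lra.
Qed.

(** The indices of the points of the parabola that [pt k] averages. *)
Definition support k (x : 'I_n) := [|| x == k, x == supl k | x == supr k].

Lemma support_fix k x j y : support k x -> support j y -> k != j -> x = j -> y = j.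
Proof.
move=> sx sy kj xj; subst x.
suff [sl sr] : supl j = j /\ supr j = j by move: sy; rewrite /support sl sr !orbb => /eqP.
move: sx; rewrite /support eq_sym (negPf kj) /= /supl /supr.
have [uk|uk] := boolP (u k); last by rewrite /= eq_sym (negPf kj).
have [upk|upk] /= := boolP (u (ord_pred k)).
  rewrite orbb => /eqP ->; rewrite upk ord_predK uk /= orbF.
  by have := uu upk; rewrite ord_predK uk orbF => /negPf ->.
have [uSk|uSk] /= := boolP (u (ordS k)); first by rewrite !(eq_sym j) (negPf kj).
by move=> /orP[] /eqP ->; rewrite ?(negPf upk) ?(negPf uSk).
Qed.

Lemma support_near k x : support k x -> [|| x == k, x == ord_pred k | x == ordS k].
Proof.
rewrite /support /supl /supr => /or3P[->//| |]; do ![case: ifP => _] => ->;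
  by rewrite ?orbT.
Qed.

Lemma cyclic_support (i j k x y z : 'I_n) : (i < j < k)%N ->
  support i x -> support j y -> support k z ->
  [|| (x <= y <= z)%N, (y <= z <= x)%N | (z <= x <= y)%N].
Proof.
move=> ijk sx sy sz.
have ij : i != j by rewrite -val_eqE /=; lia.
have ik : i != k by rewrite -val_eqE /=; lia.
have jk : j != k by rewrite -val_eqE /=; lia.
have ji : j != i by rewrite eq_sym.
have ki : k != i by rewrite eq_sym.
have kj : k != j by rewrite eq_sym.
have val_imp (a b c d : 'I_n) : (a = b -> c = d) -> (a : nat) = b -> (c : nat) = d.
  by move=> h /val_inj/h ->.
have h1 := val_imp _ _ _ _ (support_fix sx sy ij).
have h2 := val_imp _ _ _ _ (support_fix sx sz ik).
have h3 := val_imp _ _ _ _ (support_fix sy sx ji).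
have h4 := val_imp _ _ _ _ (support_fix sy sz jk).
have h5 := val_imp _ _ _ _ (support_fix sz sx ki).
have h6 := val_imp _ _ _ _ (support_fix sz sy kj).
have near (a b : 'I_n) : support a b -> near_mod n a b.
  move=> /support_near/or3P[]/eqP ->.
  - by constructor 1.
  - rewrite val_ord_pred; case: eqP => [->|]; last by constructor 2; lia.
    by constructor 4; left; split => //; lia.
  - rewrite [nat_of_ord (ordS a)]val_ordS; case: eqP => [aE|].
      by constructor 4; right.
    by constructor 3.
have nx := ltn_ord x; have ny := ltn_ord y; have nz := ltn_ord z.
have nk := ltn_ord k.
have X := near _ _ sx; have Y := near _ _ sy; have Z := near _ _ sz.
exact: (cyclic_order_near n5 ijk h1 h2 h3 h4 h5 h6 nx ny nz nk X Y Z).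
Qed.

Lemma supportP k : [/\ support k k, support k (supl k) & support k (supr k)].
Proof. by rewrite /support !eqxx !orbT. Qed.

Lemma orient_pt_gt0 (f : plane R -> R) k :
  (forall x y s t, s + t = 1 -> f (s *: x + t *: y) = s * f x + t * f y) ->
  (forall x, support k x -> 0 <= f (parabola x)) -> 0 < f (parabola k) -> 0 < f (pt k).
Proof.
move=> lf f0 fk; rewrite orient_pt//; have [e0 e1 _] := eps_bounds.
have [_ /f0 sl /f0 sr] := supportP k.
have := mulr_gt0 e0 fk.
have : 0 <= (1 - eps) * (2^-1 * f (parabola (supl k)) + 2^-1 * f (parabola (supr k))).
  by apply: mulr_ge0; [lra|apply: addr_ge0; apply: mulr_ge0; rewrite // invr_ge0].
by lra.
Qed.

Lemma orient_pt_ge0 (f : plane R -> R) k :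
  (forall x y s t, s + t = 1 -> f (s *: x + t *: y) = s * f x + t * f y) ->
  (forall x, support k x -> 0 <= f (parabola x)) -> 0 <= f (pt k).
Proof.
move=> lf f0; rewrite orient_pt//; have [e0 e1 _] := eps_bounds.
have [/f0 fk /f0 sl /f0 sr] := supportP k.
apply: addr_ge0; last by apply: mulr_ge0 => //; exact: ltW.
by apply: mulr_ge0; [lra|apply: addr_ge0; apply: mulr_ge0; rewrite // invr_ge0].
Qed.

(** Expanding one argument at a time, the orientation is a convex combination of orientations of
    support triples. These are nonnegative by cyclic order, and the triple of own points is positive
    and has positive weight. *)
Lemma convex_pt : convex_ngon pt.
Proof.
apply: ccw_convex_ngon; first by apply: leq_trans n5.
move=> i j k ijk.
have [/andP[ij jk]] := ijk.
have lin1 (a b : plane R) x y s t : s + t = 1 ->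
    orient (s *: x + t *: y) a b = s * orient x a b + t * orient y a b.
  exact: orient_linear1.
have lin2 (a b : plane R) x y s t : s + t = 1 ->
    orient b (s *: x + t *: y) a = s * orient b x a + t * orient b y a.
  exact: orient_linear2.
have lin3 (a b : plane R) x y s t : s + t = 1 ->
    orient a b (s *: x + t *: y) = s * orient a b x + t * orient a b y.
  exact: orient_linear.
have h0 x y z : support i x -> support j y -> support k z ->
    0 <= orient (parabola x) (parabola y) (parabola z).
  by move=> sx sy sz; apply: orient_parabola_ge0; apply: cyclic_support ijk sx sy sz.
have [si _ _] := supportP i; have [sj _ _] := supportP j; have [sk _ _] := supportP k.
have h1 x y : support i x -> support j y -> 0 <= orient (parabola x) (parabola y) (pt k).
  by move=> sx sy; apply: (orient_pt_ge0 (lin3 _ _)) => z; exact: h0.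
have h1' : 0 < orient (parabola i) (parabola j) (pt k).
  apply: (orient_pt_gt0 (lin3 _ _)) => [z|]; first exact: h0.
  by apply: lt_le_trans (orient_parabola_ge1 _) => //; rewrite ijk.
have h2 x : support i x -> 0 <= orient (parabola x) (pt j) (pt k).
  by move=> sx; apply: (orient_pt_ge0 (lin2 _ _)) => y; exact: h1.
have h2' : 0 < orient (parabola i) (pt j) (pt k).
  by apply: (orient_pt_gt0 (lin2 _ _)) => // y; exact: h1.
exact: (orient_pt_gt0 (lin1 _ _)).
Qed.

Lemma pt_unused k : ~~ u k -> pt k = parabola k.
Proof.
move=> uk; rewrite /pt /supl /supr (negPf uk) /=.
by rewrite -scalerDl subrKC scale1r -scalerDl subrK scale1r.
Qed.

Lemma pt_used_first k : u k -> ~~ u (ord_pred k) -> u (ordS k) -> pt k = parabola k.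
Proof.
move=> uk up us; rewrite /pt /supl /supr uk us (negPf up) /=.
by rewrite -scalerDl subrKC scale1r -scalerDl subrK scale1r.
Qed.

Lemma pt_used_second k : u k -> u (ord_pred k) ->
  pt k = (1 - eps) *: parabola (ord_pred k) + eps *: parabola k.
Proof.
move=> uk up; rewrite /pt /supl /supr uk up /=.
by rewrite -scalerDl subrKC scale1r.
Qed.

Lemma pt_used_isolated k : u k -> ~~ u (ord_pred k) -> ~~ u (ordS k) ->
  pt k = (1 - eps) *: (2^-1 *: parabola (ord_pred k) + (1 - 2^-1) *: parabola (ordS k))
    + eps *: parabola k.
Proof. by move=> uk up us; rewrite /pt /supl /supr uk (negPf up) (negPf us). Qed.

(** For [eps = 0] the ear is degenerate: [k] lies on the chord of its neighbors or coincides with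
    one of them. Only the part of weight [eps] remains. *)
Lemma ear_used k : u k -> orient (pt (ord_pred k)) (pt k) (pt (ordS k)) =
  eps * orient (parabola (ord_pred k)) (parabola k) (parabola (ordS k)).
Proof.
move=> uk; have [up|up] := boolP (u (ord_pred k)).
  have us : ~~ u (ordS k) by have := uu uk; rewrite up.
  have upp : ~~ u (ord_pred (ord_pred k)) by have := uu up; rewrite ord_predK uk orbF.
  rewrite pt_used_first ?ord_predK// (pt_unused us) pt_used_second//.
  by rewrite orient_linear2 ?subrK// orientxx mulr0 add0r.
rewrite (pt_unused up); have [us|us] := boolP (u (ordS k)).
  rewrite pt_used_first// pt_used_second ?ordSK//.
  by rewrite orient_linear ?subrK// orientxyy mulr0 add0r.
rewrite (pt_unused us) pt_used_isolated//.
rewrite orient_linear2 ?subrK// orient_linear2 ?subrKC//.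
by rewrite orientxx orientxyy !mulr0 add0r mulr0 add0r.
Qed.

Lemma ear_used_lt k : u k -> orient (pt (ord_pred k)) (pt k) (pt (ordS k)) < 8^-1.
Proof.
move=> uk; rewrite ear_used//; have [e0 _ e8] := eps_bounds.
by apply: le_lt_trans e8; rewrite ler_pM2l//; apply: orient_parabola_le; exact: ltn_ord.
Qed.

(** An isolated used neighbor puts weight [(1 - eps) / 2] on the point of [k], which contributes
    nothing; weight at least 1/2 remains on orientations that are at least 1. Two such neighbors
    give 1/4. *)
Lemma ear_unused_ge k : ~~ u k -> 4^-1 <= orient (pt (ord_pred k)) (pt k) (pt (ordS k)).
Proof.
move=> uk; have [e0 e1 _] := eps_bounds.
have up : u (ord_pred k) by have := uS (ord_pred k); rewrite ord_predK (negPf uk) orbF.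
have us : u (ordS k) by have := uS k; rewrite (negPf uk).
rewrite (pt_unused uk).
have nk := ltn_ord k.
(* Two steps back and two steps forward from [k] do not meet when [n >= 5], so the triple is in
   strict cyclic order. *)
have V (x z : 'I_n) : [\/ x = ord_pred k | x = ord_pred (ord_pred k)] ->
    [\/ z = ordS k | z = ordS (ordS k)] ->
    1 <= orient (parabola x) (parabola k) (parabola z).
  move=> xE zE; apply: orient_parabola_ge1.
  have pm (a : 'I_n) : ((ord_pred a).+1 = a \/ (ord_pred a).+1 = a + n)%N.
    rewrite val_ord_pred; case: eqP => [->|/eqP a0]; last by left; rewrite prednK// lt0n.
    by right; rewrite prednK// (leq_trans _ n5).
  have sm (a : 'I_n) : (ordS a = a.+1 :> nat \/ ordS a + n = a.+1)%N.
    by rewrite [nat_of_ord (ordS a)]val_ordS; case: eqP => [->|_]; [right|left].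
  have xv : (x.+1 = k \/ x.+1 = k + n \/ x.+2 = k \/ x.+2 = k + n)%N.
    case: xE => ->; first by case: (pm k); tauto.
    by have := pm k; have := pm (ord_pred k); have := ltn_ord (ord_pred (ord_pred k));
      clear -n5; lia.
  have zv : (z = k.+1 :> nat \/ z + n = k.+1 \/ z = k.+2 :> nat \/ z + n = k.+2)%N.
    case: zE => ->; first by case: (sm k); tauto.
    by have := sm k; have := sm (ordS k); clear -n5 nk; lia.
  have nx := ltn_ord x; have nz := ltn_ord z.
  by case: xv => [|[|[|]]] xk; case: zv => [|[|[|]]] zk; clear -n5 nx nz nk xk zk; lia.
have half (x : 'I_n) : [\/ x = ord_pred k | x = ord_pred (ord_pred k)] ->
    2^-1 <= orient (parabola x) (parabola k) (pt (ordS k)).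
  move=> xE; have [uss|uss] := boolP (u (ordS (ordS k))).
    rewrite pt_used_first ?ordSK//.
    by have := V x (ordS k) xE (or_introl erefl); lra.
  rewrite pt_used_isolated ?ordSK// orient_linear ?subrK// orient_linear ?subrKC//.
  rewrite orientxyy.
  have := V x (ordS k) xE (or_introl erefl); have := V x (ordS (ordS k)) xE (or_intror erefl).
  by nra.
have [upp|upp] := boolP (u (ord_pred (ord_pred k))).
  rewrite pt_used_second// orient_linear1 ?subrK//.
  have := half _ (or_introl erefl); have := half _ (or_intror erefl).
  by nra.
rewrite pt_used_isolated ?ord_predK// orient_linear1 ?subrK// orient_linear1 ?subrKC//.
rewrite orientxx.
have := half _ (or_introl erefl); have := half _ (or_intror erefl).
by nra.
Qed.

Lemma unique_min_area_pt : exists (m : nat) (q : 'I_m -> plane R),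
  unique_min_area_inscribed pt q /\ forall k, range q (pt k) <-> u k.
Proof.
have cp := convex_pt.
pose q (j : 'I_#|u|) := pt (enum_val j).
have cq : convex_ngon q.
  apply: ccw_convex_ngon; first exact: card_used_ge3.
  move=> i j k /andP[ij jk]; apply: (convex_ngon_ccw cp).
  by rewrite !enum_val_ltn.
have qp j : exists2 k, u k & q j = pt k by exists (enum_val j) => //; exact: enum_valP.
have pq k : u k -> range q (pt k).
  move=> uk; exists (enum_rank_in uk k) => //.
  by rewrite /q enum_rankK_in.
exists #|u|, q; split; last first.
  move=> k; split; last exact: pq.
  by move=> [j _ /(convex_ngon_inj cp) <-]; exact: enum_valP.
apply: (ear_criterion cp cq qp pq uS uu) => k uk.
have up : u (ord_pred k) by have := uS (ord_pred k); rewrite ord_predK (negPf uk) orbF.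
have us : u (ordS k) by have := uS k; rewrite (negPf uk).
by have := ear_unused_ge uk; have := ear_used_lt up; have := ear_used_lt us; lra.
Qed.

End Construction.

Theorem theorem2 (R : realType) (n : nat) (s : {ffun 'I_n -> mark})
    (hn : (5 <= n)%N) :
  (exists p : 'I_n -> plane R, convex_ngon p /\
     exists (m : nat) (q : 'I_m -> plane R),
       unique_min_area_inscribed p q /\ used_seq p q = s)
  <->
  (no_two_consecutive_unused s /\ no_three_consecutive_used s).
Proof.
split=> [[p [cp [m [q [uq <-]]]]]|[no2 no3]]; first exact: necessity.
pose u : pred 'I_n := fun k => if s k is Used then true else false.
have uU k : u k -> s k = Used by rewrite /u; case: (s k).
have uN k : ~~ u k -> s k = Unused by rewrite /u; case: (s k).
have uS k : u k || u (ordS k).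
  apply/negP => /negP; rewrite negb_or => /andP[/uN a /uN b]; apply: no2; by exists k.
have uu k : u k -> ~~ u (ord_pred k) || ~~ u (ordS k).
  move=> uk; rewrite -negb_and; apply/negP => /andP[/uU a /uU b]; apply: no3.
  by exists (ord_pred k); rewrite !ord_predK (uU k uk).
exists (pt R u); split; first exact: convex_pt.
have [m [q [uq qP]]] := unique_min_area_pt R hn uS uu.
exists m, q; split => //; apply/ffunP => k; rewrite ffunE.
case: ifPn => [|]; first by rewrite inE => /qP/uU.
by rewrite notin_setE => nq; apply/esym/uN/negP => /qP.
Qed.
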